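(* Let $(M,\,{}^0T'',\zeta)$ be a normal strongly pseudoconvex CR-manifold with $\dim_{\mathbb R}M=2n-1\ge 7$ whose canonical line bundle $K_M=\wedge^n(T')^*$ is trivial in the CR-sense, with a fixed nowhere vanishing section $\omega\in\Gamma(M,\wedge^n(T')^* )$ satisfying $d''\omega=0$. Let $l\ge 1$ be an integer and let $\phi_1,\dots,\phi_l\in\mathbf Z^1$ satisfy $$\overline\partial_b(\imath_1^{-1}\phi_1)=0$$ and, for every $k=2,\dots,l$, $$\overline\partial_b(\imath_1^{-1}\phi_k)=-\frac12\sum_{\substack{m+h=k\\ m,h\ge1}}[\imath_1^{-1}\phi_m,\imath_1^{-1}\phi_h].$$ Then $$\overline\partial_b\Bigl(\sum_{\substack{m+h=l+1\\ m,h\ge1}}[\imath_1^{-1}\phi_m,\imath_1^{-1}\phi_h]\Bigr)=0.$$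
   Context: **CR-manifold.** $M$ is a compact orientable $C^\infty$ manifold of real dimension $2n-1$, and ${}^0T''\subset\mathbb C\otimes TM$ is a complex subbundle of rank $n-1$ with ${}^0T''\cap{}^0\overline T''=0$ (where ${}^0\overline T''=\overline{{}^0T''}$) and $[\Gamma(U,{}^0T''),\Gamma(U,{}^0T'')]\subset\Gamma(U,{}^0T'')$ for every open $U\subseteq M$. **Normal strongly pseudoconvex.** $\zeta$ is a global real vector field on $M$ with $\zeta_p\notin{}^0T''_p+{}^0\overline T''_p$ for every $p\in M$ and $[\zeta,\Gamma(M,{}^0T'')]\subseteq\Gamma(M,{}^0T'')$. Thus $\mathbb C\otimes TM={}^0T''\oplus{}^0\overline T''\oplus\mathbb C\zeta$. The Levi form $L(X,Y)=-\sqrt{-1}\,[X,\overline Y]_{\mathbb C\zeta}$, $X,Y\in{}^0T''$ (the $\mathbb C\zeta$-component in this decomposition), is assumed to be (positive or negative) definite at each point. Subscripts such as $[\cdot,\cdot]_{{}^0T''}$ or $[\cdot,\cdot]_{T'}$ denote components with respect to this decomposition, where $T'={}^0\overline T''+\mathbb C\zeta$. The dual bundles $({}^0T'')^*$, $({}^0\overline T'')^*$, $(\mathbb C\zeta)^*$, $(T')^*$ are regarded as bundles of complex $1$-forms on $M$ via the decomposition. Let $\theta$ be the $1$-form with $\theta|_{{}^0T''+{}^0\overline T''}=0$ and $\theta(\zeta)=1$. **Forms and operators.** For $u\in\Gamma\bigl(M,(\mathbb C\zeta)^*\wedge\wedge^p({}^0\overline T'')^*\wedge\wedge^q({}^0T'')^*\bigr)$,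 $d'u$ is the component of $du$ in $(\mathbb C\zeta)^*\wedge\wedge^{p+1}({}^0\overline T'')^*\wedge\wedge^q({}^0T'')^*$, and $d''u$ is the component of $du$ in $(\mathbb C\zeta)^*\wedge\wedge^p({}^0\overline T'')^*\wedge\wedge^{q+1}({}^0T'')^*$. Define $$\mathbf F^{p,q}=\{u\in\Gamma(M,(\mathbb C\zeta)^*\wedge\wedge^p({}^0\overline T'')^*\wedge\wedge^q({}^0T'')^* ):\ d\theta\wedge(\zeta\lrcorner u)=0\},\qquad \mathbf Z^q=\{\alpha\in\mathbf F^{n-2,q}:\ d'\alpha=0\}.$$ **Trivial in the CR-sense.** $K_M=\wedge^n(T')^*$ is trivial in the CR-sense if it has a nowhere vanishing global section $\omega$ with $d''\omega=0$. **Contraction and $\imath_q$.** For a vector field $X$ in $T'$ and a section $\eta$ of $\wedge^q({}^0T'')^*$, the contraction of a form $\rho$ by $X\otimes\eta$ is $(X\otimes\eta)\lrcorner\rho=\eta\wedge(X\lrcorner\rho)$, where $X\lrcorner$ is interior multiplication; this is extended linearly. The bundle isomorphism $\imath_q:T'\otimes\wedge^q({}^0T'')^*\to\wedge^{n-1}(T')^*\wedge\wedge^q({}^0T'')^*$ is $\imath_q(u)=u\lrcorner\omega$. It restricts to an isomorphism of ${}^0\overline T''\otimes\wedge^q({}^0T'')^*$ onto $(\mathbb C\zeta)^*\wedge\wedge^{n-2}({}^0\overline T'')^*\wedge\wedge^q({}^0T'')^*$, so $\imath_1^{-1}\phi_k\in\Gamma(M,{}^0\overline T''\otimes({}^0T'')^*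 )$. **Bracket.** For $\phi,\psi\in\Gamma(M,{}^0\overline T''\otimes({}^0T'')^* )$, the bracket $[\phi,\psi]\in\Gamma(M,{}^0\overline T''\otimes\wedge^2({}^0T'')^* )$ is defined, for $X,Y\in\Gamma(M,{}^0T'')$, by $$[\phi,\psi](X,Y)=[\phi(X),\psi(Y)]+[\psi(X),\phi(Y)]-\phi\bigl([X,\psi(Y)]_{{}^0T''}+[\psi(X),Y]_{{}^0T''}\bigr)-\psi\bigl([\phi(X),Y]_{{}^0T''}+[X,\phi(Y)]_{{}^0T''}\bigr).$$ **Tangential Cauchy–Riemann operator.** The $T'$-valued tangential Cauchy–Riemann operator $\overline\partial_b:\Gamma(M,T'\otimes\wedge^q({}^0T'')^* )\to\Gamma(M,T'\otimes\wedge^{q+1}({}^0T'')^* )$ is, for $X_1,\dots,X_{q+1}\in\Gamma(M,{}^0T'')$, $$\overline\partial_b\phi(X_1,\dots,X_{q+1})=\sum_{j=1}^{q+1}(-1)^{j-1}[X_j,\phi(X_1,\dots,\widehat{X_j},\dots,X_{q+1})]_{T'}+\sum_{j<k}(-1)^{j+k}\phi([X_j,X_k],X_1,\dots,\widehat{X_j},\dots,\widehat{X_k},\dots,X_{q+1}).$$ *)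

(* Defs.v *)
From HB Require Import structures.
From mathcomp Require Import all_boot all_order all_algebra all_fingroup.
From mathcomp Require Import complex.
From mathcomp Require Import all_classical all_reals all_analysis.

Set Implicit Arguments.
Unset Strict Implicit.
Unset Printing Implicit Defensive.

Import Order.TTheory GRing.Theory Num.Theory.
Import numFieldNormedType.Exports.

Local Open Scope classical_set_scope.
Local Open Scope ring_scope.
Local Open Scope complex_scope.

(** * Smooth manifolds *)

Section Euclidean.
Context {R : realType} {m : nat}.
Implicit Types (D : set 'rV[R]_m) (f : 'rV[R]_m -> R).

Definition partial f (i : 'I_m) : 'rV[R]_m -> R :=
  fun x => 'D_(delta_mx ord0 i) f x.

Fixpoint Ck (k : nat) D f : Prop :=
  {in D, continuous f} /\
  if k is k'.+1 then
    forall i, (forall x, D x -> derivable f x (delta_mx ord0 i)) /\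
              Ck k' D (partial f i)
  else True.

Definition Cinfty D f : Prop := forall k, Ck k D f.

End Euclidean.

Record chart (R : realType) (m : nat) (T : topologicalType) := Chart {
  cdom : set T;
  cmap : T -> 'rV[R]_m;
  cinv : 'rV[R]_m -> T;
  chart_open_dom : open cdom;
  chart_open_img : open (cmap @` cdom);
  chart_cancel : {in cdom, cancel cmap cinv};
  chart_continuous : {in cdom, continuous cmap};
  chart_inv_continuous : {in cmap @` cdom, continuous cinv} }.

Section Charts.
Context {R : realType} {m : nat} {T : topologicalType}.
Implicit Types (c d : chart R m T) (A : set (chart R m T)).

Definition transition c d (j : 'I_m) : 'rV[R]_m -> R :=
  fun x => cmap d (cinv c x) ord0 j.

Definition compatible c d : Prop :=
  forall j, Cinfty (cmap c @` (cdom c `&` cdom d)) (transition c d j).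

Definition smooth_atlas A : Prop :=
  (forall p : T, exists2 c, A c & cdom c p) /\
  (forall c d, A c -> A d -> compatible c d).

Definition positively_oriented A : Prop :=
  forall c d, A c -> A d -> forall p, cdom c p -> cdom d p ->
    0 < \det (\matrix_(i < m, j < m) partial (transition c d j) i (cmap c p)).

End Charts.

Record smooth_manifold (R : realType) (m : nat) := SmoothManifold {
  carrier :> topologicalType;
  atlas : set (chart R m carrier);
  manifold_hausdorff : hausdorff_space carrier;
  manifold_second_countable : @second_countable carrier;
  manifold_atlas : smooth_atlas atlas }.

Arguments atlas {R m} _ _.

Definition orientable (R : realType) (m : nat) (M : smooth_manifold R m) : Prop :=
  exists A : set (chart R m M),
    [/\ smooth_atlas (A `|` atlas M), smooth_atlas A & positively_oriented A].

(** * Complex vector fields and complex forms *)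

Section Fields.
Context {R : realType} {m : nat} (M : smooth_manifold R m).
Local Notation C := R[i].

Definition smooth (U : set M) (f : M -> C) : Prop :=
  forall c, atlas M c ->
    Cinfty (cmap c @` (U `&` cdom c)) (fun x => complex.Re (f (cinv c x))) /\
    Cinfty (cmap c @` (U `&` cdom c)) (fun x => complex.Im (f (cinv c x))).

Definition smooth_near (p : M) (f : M -> C) : Prop :=
  exists U : set M, [/\ open U, U p & smooth U f].

Definition coord_partial (c : chart R m M) (i : 'I_m) (f : M -> C) (p : M) : C :=
  partial (fun x => complex.Re (f (cinv c x))) i (cmap c p) +i*
  partial (fun x => complex.Im (f (cinv c x))) i (cmap c p).

(** A complex tangent vector acts on functions that are smooth near its base
    point.  It is 0 on all other functions, so that tangent vectors are equal
    when they are equal as functionals. *)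
Definition functional := (M -> C) -> C^o.

Definition tangent (p : M) (v : functional) : Prop :=
  forall c, atlas M c -> cdom c p ->
    exists a : 'I_m -> C, forall f : M -> C,
      v f = if `[< smooth_near p f >]
            then \sum_(i < m) a i * coord_partial c i f p else 0.

(** A field is a family of functionals; being a smooth vector field on an open
    set [U] is a predicate, and the values outside [U] are irrelevant. *)
Definition field := M -> functional.

Definition apply_field (X : field) (f : M -> C) : M -> C := fun p => X p f.

Definition vfield (U : set M) (X : field) : Prop :=
  (forall p, U p -> tangent p (X p)) /\
  (forall (V : set M) f, open V -> V `<=` U -> smooth V f ->
     smooth V (apply_field X f)).

Definition lie (X Y : field) : field := fun p f =>
  if `[< smooth_near p f >]
  then X p (apply_field Y f) - Y p (apply_field X f) else 0.

Definition conjv (v : functional) : functional :=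
  fun f => (v (fun x => (f x)^*))^*.

Definition conjf (X : field) : field := fun p => conjv (X p).

(** [Gamma U S X] : [X] is a smooth section over [U] of [S]. *)
Definition Gamma (U : set M) (S : M -> set functional) (X : field) : Prop :=
  vfield U X /\ forall p, U p -> S p (X p).

Definition is_basis (r : nat) (S : set functional) (b : 'I_r -> functional) : Prop :=
  (forall v, S v <-> exists a : 'I_r -> C, v = \sum_(i < r) a i *: b i) /\
  (forall a : 'I_r -> C, \sum_(i < r) a i *: b i = 0 -> forall i, a i = 0).

Definition subbundle (r : nat) (S : M -> set functional) : Prop :=
  forall p, exists (U : set M) (b : 'I_r -> field),
    [/\ open U, U p, forall i, vfield U (b i) &
        forall q, U q -> is_basis (S q) (fun i => b i q)].

(** [k]-forms, and forms with values in vector fields, through their values on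
    [k]-tuples of fields. *)
Definition cochain (k : nat) := ('I_k -> field) -> M -> C.
Definition vcochain (k : nat) := ('I_k -> field) -> field.

Definition set_arg k (i : 'I_k) (Y : field) (X : 'I_k -> field) : 'I_k -> field :=
  fun j => if j == i then Y else X j.

Definition cons_arg k (Y : field) (X : 'I_k -> field) : 'I_k.+1 -> field :=
  fun i => if unlift ord0 i is Some j then X j else Y.

Definition omit1 k (X : 'I_k.+1 -> field) (i : 'I_k.+1) : 'I_k -> field :=
  fun j => X (lift i j).

(** The tuple [Y, X_0, ..., X_k] with [X_i] and [X_j] left out. *)
Definition omit2 k (Y : field) (X : 'I_k.+1 -> field) (i j : 'I_k.+1) :
    'I_k -> field :=
  fun l => nth 0 (Y :: [seq X h | h <- enum 'I_k.+1 & (h != i) && (h != j)]) l.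

(** Smooth sections of the [k]-th exterior power of the complexified cotangent
    bundle.  Additivity and homogeneity are required at each point, so that the
    value at [p] depends only on the values of the arguments at [p]. *)
Definition is_form k (alpha : cochain k) : Prop :=
  forall (U : set M) (X : 'I_k -> field),
    open U -> (forall i, vfield U (X i)) ->
    [/\ smooth U (alpha X),
        (forall i j p, i != j -> U p -> X i p = X j p -> alpha X p = 0) &
        (forall i p (a : C) Y Z, U p -> vfield U Y -> vfield U Z ->
           X i p = a *: Y p + Z p ->
           alpha X p = a * alpha (set_arg i Y X) p + alpha (set_arg i Z X) p)].

(** Equality of forms. *)
Definition eqform k (alpha beta : cochain k) : Prop :=
  forall (U : set M) (X : 'I_k -> field),
    open U -> (forall i, vfield U (X i)) ->
    forall p, U p -> alpha X p = beta X p.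

Definition wedge a b (alpha : cochain a) (beta : cochain b) : cochain (a + b) :=
  fun X p => ((a`! * b`!)%N%:R)^-1 *
    \sum_(s : 'S_(a + b)) (-1) ^+ s *
      (alpha (fun i => X (s (lshift b i))) p *
       beta (fun j => X (s (rshift a j))) p).

Definition interior k (Y : field) (rho : cochain k.+1) : cochain k :=
  fun X => rho (cons_arg Y X).

(** The linear extension of [(Y (x) eta) _| rho = eta /\ (Y _| rho)] to
    vector-valued [q]-forms [u]. *)
Definition contract q r (u : vcochain q) (rho : cochain r.+1) : cochain (q + r) :=
  fun X p => ((q`! * r`!)%N%:R)^-1 *
    \sum_(s : 'S_(q + r)) (-1) ^+ s *
      interior (u (fun i => X (s (lshift r i)))) rho
               (fun j => X (s (rshift q j))) p.

(** Exterior derivative (Koszul formula). *)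
Definition dext k (alpha : cochain k) : cochain k.+1 :=
  fun X p =>
    \sum_(i < k.+1) (-1) ^+ i * X i p (alpha (omit1 X i)) +
    \sum_(i < k.+1) \sum_(j < k.+1 | (i < j)%N)
      (-1) ^+ (i + j) * alpha (omit2 (lie (X i) (X j)) X i j) p.

End Fields.

(** * Normal strongly pseudoconvex CR-structures *)

Section CR.
Context {R : realType} {m : nat} {M : smooth_manifold R m}.
Local Notation C := R[i].
Local Notation functional := (functional M).
Local Notation field := (field M).
Local Notation cochain := (cochain M).
Local Notation vcochain := (vcochain M).
Variables (E : M -> set functional) (zeta : field).

Definition Ebar (p : M) : set functional := [set v | E p (conjv v)].

Record is_cr (n : nat) : Prop := {
  cr_dim : m = (2 * n - 1)%N;
  cr_compact : compact [set: M];
  cr_orientable : orientable M;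
  cr_subbundle : subbundle n.-1 E;
  cr_transverse : forall p v, E p v -> Ebar p v -> v = 0;
  cr_involutive : forall (U : set M) X Y, open U ->
    Gamma U E X -> Gamma U E Y -> Gamma U E (lie X Y) }.

(** The components of a tangent vector in [E], [Ebar] and [C zeta]. *)
Definition cr_split (p : M) (v : functional) : functional * functional * functional :=
  xget (0, 0, 0) [set w | [/\ E p w.1.1, Ebar p w.1.2,
    exists a : C, w.2 = a *: zeta p & v = w.1.1 + w.1.2 + w.2]].

Definition prE (X : field) : field := fun p => (cr_split p (X p)).1.1.
Definition prEbar (X : field) : field := fun p => (cr_split p (X p)).1.2.
Definition przeta (X : field) : field := fun p => (cr_split p (X p)).2.
Definition prT' (X : field) : field := fun p => prEbar X p + przeta X p.

Definition T' (p : M) : set functional :=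
  [set v | exists w (a : C), Ebar p w /\ v = w + a *: zeta p].

Definition theta : cochain 1 :=
  fun X p => xget 0 [set a : C | przeta (X ord0) p = a *: zeta p].

(** The Levi form, with [C zeta] identified with [C] by means of [zeta]. *)
Definition levi (X Y : field) (p : M) : C :=
  - 'i * theta (fun _ => lie X (conjf Y)) p.

Definition levi_positive (p : M) : Prop :=
  forall (U : set M) X, open U -> U p -> Gamma U E X -> X p <> 0 ->
    0 < levi X X p.

Definition levi_negative (p : M) : Prop :=
  forall (U : set M) X, open U -> U p -> Gamma U E X -> X p <> 0 ->
    levi X X p < 0.

Record is_normal_spc (n : nat) : Prop := {
  spc_cr : is_cr n;
  spc_field : vfield [set: M] zeta;
  spc_real : conjf zeta = zeta;
  spc_transverse : forall p v w, E p v -> Ebar p w -> zeta p <> v + w;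
  spc_normal : forall X, Gamma [set: M] E X -> Gamma [set: M] E (lie zeta X);
  spc_definite : forall p, levi_positive p \/ levi_negative p }.

(** The component of a [k]-form, [k = p + q + 1], in
    [(C zeta)^* /\ ^p Ebar^* /\ ^q E^*]: the sum over the choices of the one
    argument projected to [C zeta] and of the [q] arguments projected to [E]. *)
Definition component k (p q : nat) (alpha : cochain k) : cochain k :=
  fun X x =>
    \sum_(i < k) \sum_(S : {set 'I_k} |
        [&& k == (p + q).+1, #|S| == q & i \notin S])
      alpha (fun j => if j == i then przeta (X j)
                      else if j \in S then prE (X j) else prEbar (X j)) x.

Definition has_bidegree k (p q : nat) (alpha : cochain k) : Prop :=
  [/\ k = (p + q).+1, is_form alpha & eqform (component p q alpha) alpha].

Definition d' k (p q : nat) (alpha : cochain k) : cochain k.+1 :=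
  component p.+1 q (dext alpha).

Definition d'' k (p q : nat) (alpha : cochain k) : cochain k.+1 :=
  component p q.+1 (dext alpha).

Definition in_F k (p q : nat) (u : cochain k.+1) : Prop :=
  has_bidegree p q u /\
  eqform (wedge (dext theta) (interior zeta u)) (fun _ _ => 0).

Definition in_Z (n : nat) k (q : nat) (alpha : cochain k.+1) : Prop :=
  in_F (n - 2) q alpha /\ eqform (d' (n - 2) q alpha) (fun _ _ => 0).

(** Nowhere vanishing sections of [^k (T')^*], as forms on [M]. *)
Definition T'_form k (alpha : cochain k) : Prop :=
  is_form alpha /\ eqform (fun X => alpha (fun i => prT' (X i))) alpha.

Definition nowhere_vanishing k (alpha : cochain k) : Prop :=
  forall p, exists (U : set M) (X : 'I_k -> field),
    [/\ open U, U p, forall i, vfield U (X i) & alpha X p != 0].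

(** Top-degree sections [omega] of [^n (T')^*] have bidegree [(n-1, 0)], as
    [T'] has rank [n]. *)
Definition cr_trivialization (n : nat) (omega : cochain n.-1.+1) : Prop :=
  [/\ T'_form omega, nowhere_vanishing omega &
      eqform (d'' n.-1 0 omega) (fun _ _ => 0)].

(** Smooth sections of [S (x) ^q E^*]. *)
Definition is_vform (S : M -> set functional) q (u : vcochain q) : Prop :=
  forall (U : set M) (X : 'I_q -> field),
    open U -> (forall i, vfield U (X i)) ->
    [/\ Gamma U S (u X),
        (forall i p, U p -> T' p (X i p) -> u X p = 0),
        (forall i j p, i != j -> U p -> X i p = X j p -> u X p = 0) &
        (forall i p (a : C) Y Z, U p -> vfield U Y -> vfield U Z ->
           X i p = a *: Y p + Z p ->
           u X p = a *: u (set_arg i Y X) p + u (set_arg i Z X) p)].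

Definition imath n q (omega : cochain n.+1) (u : vcochain q) : cochain (q + n) :=
  contract u omega.

(** The inverse of [imath] on sections of [Ebar (x) ^q E^*]. *)
Definition imath_inv n q (omega : cochain n.+1) (alpha : cochain (q + n)) : vcochain q :=
  xget (fun _ => 0) [set u | is_vform Ebar u /\ eqform (imath omega u) alpha].

Definition app (u : vcochain 1) (X : field) : field := u (fun _ => X).

(** The formulas for [cr_bracket] and [dbar] are meaningful on tuples of global
    sections of [E] only, which is where [eq_vform] compares. *)
Definition cr_bracket (phi psi : vcochain 1) : vcochain 2 :=
  fun V => let X := V ord0 in let Y := V ord_max in
    lie (app phi X) (app psi Y) + lie (app psi X) (app phi Y)
    - app phi (prE (lie X (app psi Y)) + prE (lie (app psi X) Y))
    - app psi (prE (lie (app phi X) Y) + prE (lie X (app phi Y))).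

Definition dbar q (phi : vcochain q) : vcochain q.+1 :=
  fun X =>
    \sum_(j < q.+1) (-1) ^+ j *: prT' (lie (X j) (phi (omit1 X j))) +
    \sum_(j < q.+1) \sum_(k < q.+1 | (j < k)%N)
      (-1) ^+ (j + k) *: phi (omit2 (lie (X j) (X k)) X j k).

(** Equality of sections of [T' (x) ^q E^*]. *)
Definition eq_vform q (u w : vcochain q) : Prop :=
  forall X : 'I_q -> field, (forall i, Gamma [set: M] E (X i)) -> u X = w X.

End CR.

(* Main.v *)
Require Import Defs.
From HB Require Import structures.
From mathcomp Require Import all_boot all_order all_algebra.
From mathcomp Require Import complex.
From mathcomp Require Import all_classical all_reals all_analysis.
From mathcomp Require Import zify ring lra.
Import Order.TTheory GRing.Theory Num.Theory.
Import numFieldNormedType.Exports.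

Set Implicit Arguments.
Unset Strict Implicit.
Unset Printing Implicit Defensive.

Local Open Scope classical_set_scope.
Local Open Scope ring_scope.
Local Open Scope complex_scope.

(** A family [psi = sum_k t^k psi_k] of [Ebar]-valued forms describes the
    deformation of the subbundle [E] into the graph of [1 + psi].  The
    obstruction to involutivity of the graph is
      [Omega(X, Y) = Pi [eX, eY]], with [e = 1 + psi] and [Pi w = w - e (P w)],
    where [P] is the projection to [E]; as [Ebar] is involutive, its coefficient
    of [t^k] is [dbar psi_k + 1/2 sum_(m + h = k) [psi_m, psi_h]].  Applying [Pi]
    to the Jacobi identity of [eX], [eY], [eZ] gives a Bianchi identity.  By
    hypothesis [Omega] vanishes up to order [l], so the coefficient of [t^(l+1)]
    of the Bianchi identity is the closedness of [Omega_(l+1)], that is, of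
    [1/2 sum_(m + h = l + 1) [psi_m, psi_h]].

    This needs the smooth vector fields to form a Lie algebra on which [P] acts.
    That a bracket of vector fields is a vector field is the symmetry of second
    derivatives; that [P] preserves smoothness is Cramer's rule in a local
    frame of [E], [Ebar] and [zeta]. *)

(** * Deformations of a Lie subalgebra *)

(** The algebra takes place in a bare Z-module with a Lie bracket and the projection [P]. This
    suffices because the [T']-component of a smooth field [v] is [v - P v], so that the components
    in [Ebar] and along [zeta] are never separated. The factor 1/2 is avoided by stating every
    identity doubled, and 2-torsion is excluded at the end. The point of the Bianchi identity is
    that a term [[W, e z]] does not consist of obstructions only: its part inside the graph is
    [[e u, e z]] with [u = P W], whose own [Pi]-part is again an obstruction and whose graph part
    must cancel. It cancels because [P] of the Jacobi identity in the lower orders makes the cyclic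
    sum of these parts vanish. The series is cut off after order [l]: then the obstruction of order
    [l + 1] has no linear term and is exactly half the sum of brackets. On the analytic side, a
    [field] is an arbitrary family of functionals, for which additivity of [lie] and the Jacobi
    identity can fail, whereas the algebra uses them without side conditions. The global smooth
    fields are therefore bundled into a type of their own. *)

Section AdditiveMaps.
Context (V W : zmodType) (f : V -> W) (fD : {morph f : x y / x + y}).

Lemma morphD0 : f 0 = 0.
Proof. by apply: (addIr (f 0)); rewrite -fD !add0r. Qed.

Lemma morphDN : {morph f : x / - x}.
Proof. by move=> x; apply: (addIr (f x)); rewrite -fD !addNr morphD0. Qed.

Lemma morphDB : {morph f : x y / x - y}.
Proof. by move=> x y; rewrite fD morphDN. Qed.

Lemma morphD_sum (I : Type) (r : seq I) (Q : pred I) (F : I -> V) :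
  f (\sum_(i <- r | Q i) F i) = \sum_(i <- r | Q i) f (F i).
Proof. exact: (big_morph f fD morphD0). Qed.

End AdditiveMaps.

(** * Sums over pairs and triples of indices with a given total *)

Section Convolution.
Context (V : zmodType).

Lemma conv_rev k (F : nat -> nat -> V) :
  \sum_(i < k.+1) F i (k - i)%N = \sum_(i < k.+1) F (k - i)%N i.
Proof.
rewrite (reindex_inj rev_ord_inj) /=; apply: eq_bigr => i _.
by rewrite subSS subKn // -ltnS.
Qed.

(** Both sides sum [F a b c] over [a + b + c = k]; the left side groups the triples by [a + b], the
    right side by [a]. *)
Lemma conv_assoc k (F : nat -> nat -> nat -> V) :
  \sum_(i < k.+1) \sum_(j < i.+1) F j (i - j)%N (k - i)%N =
  \sum_(i < k.+1) \sum_(j < (k - i).+1) F i j (k - i - j)%N.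
Proof.
have H (i : 'I_k.+1) : \sum_(j < i.+1) F j (i - j)%N (k - i)%N =
    \sum_(j < k.+1 | (j <= i)%N) F j (i - j)%N (k - i)%N.
  by rewrite (big_ord_widen k.+1 (fun j => F j (i - j)%N (k - i)%N)) ?ltn_ord.
rewrite (eq_bigr _ (fun i _ => H i)) (exchange_big_dep predT) //=.
apply: eq_bigr => j _; rewrite -(big_mkord (fun i => (j <= i)%N)
  (fun i => F j (i - j)%N (k - i)%N)) -(big_mkord predT (fun i => F j i (k - j - i)%N)).
have jk : (j <= k)%N by rewrite -ltnS.
rewrite (big_cat_nat (n := j)) //=; last by rewrite leqW.
rewrite big_nat_cond big1 ?add0r; last by move=> i; lia.
rewrite -{1}[j : nat]add0n big_addn subSn //.
rewrite big_nat_cond [RHS]big_nat_cond; apply: eq_big => [i|i /andP[/andP[_ ik] _]].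
  by rewrite leq_addl.
by rewrite addnK; congr (F _ _ _); lia.
Qed.

(** The set of triples with total [k] is invariant under rotation. This brings the three terms of
    the Jacobi identity to one common index set. *)
Lemma conv_cycle k (F : nat -> nat -> nat -> V) :
  \sum_(i < k.+1) \sum_(j < i.+1) F (i - j)%N (k - i)%N j =
  \sum_(i < k.+1) \sum_(j < i.+1) F j (i - j)%N (k - i)%N.
Proof.
rewrite (conv_assoc k (fun a b c => F b c a)).
rewrite (conv_rev k (fun i l => \sum_(j < l.+1) F j (l - j)%N i)).
by [].
Qed.

Lemma conv_cycle2 k (F : nat -> nat -> nat -> V) :
  \sum_(i < k.+1) \sum_(j < i.+1) F (k - i)%N j (i - j)%N =
  \sum_(i < k.+1) \sum_(j < i.+1) F j (i - j)%N (k - i)%N.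
Proof. by rewrite -(conv_cycle k (fun a b c => F c a b)). Qed.

End Convolution.

(** [E] is the image of the projection [P], and [phi] takes values in the
    kernel; [deform k] is the coefficient of [t^k] of [1 + sum_k t^k phi_k]
    (so [phi 0] is ignored), [deform_br] that of the bracket of two deformed
    elements. *)
Section Deformation.
Context (V : zmodType) (br : V -> V -> V) (P : V -> V) (phi : nat -> V -> V).
Context (brDl : forall y, {morph br^~ y : x x' / x + x'}).
Context (brC : forall x y, br x y = - br y x).
Context (jacobi : forall x y z,
  br (br x y) z + br (br y z) x + br (br z x) y = 0).
Context (PD : {morph P : x y / x + y}).
Context (P_br : forall x y, P x = x -> P y = y -> P (br x y) = br x y).
Context (phiD : forall k, {morph phi k : x y / x + y}).
Context (P_phi : forall k x, P (phi k x) = 0).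
Context (PK : forall x, P (P x) = P x).

Definition deform k x := if k is 0 then x else phi k x.
Local Notation e := deform.

Definition deform_br x y k := \sum_(i < k.+1) br (e i x) (e (k - i) y).
Local Notation W := deform_br.

Definition obstruction x y k :=
  W x y k - \sum_(i < k.+1) e i (P (W x y (k - i))).
Local Notation Omega := obstruction.

Lemma brDr x : {morph br x : y y' / y + y'}.
Proof. by move=> y y'; rewrite brC brDl opprD -!(brC x). Qed.

Lemma deformD k : {morph e k : x y / x + y}.
Proof. by case: k => [|k] x y //=; rewrite phiD. Qed.

Lemma br_suml (I : Type) (r : seq I) (F : I -> V) y :
  br (\sum_(i <- r) F i) y = \sum_(i <- r) br (F i) y.
Proof. exact: (morphD_sum (brDl y)). Qed.

(** The coefficient of [t^k] of the Jacobi identity for the deformed [x], [y], [z]: once the three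
    sums are rotated to the same triples of orders, it holds triple by triple. *)
Lemma jacobi_conv x y z k :
  (\sum_(i < k.+1) br (W x y i) (e (k - i) z)) +
  (\sum_(i < k.+1) br (W y z i) (e (k - i) x)) +
  (\sum_(i < k.+1) br (W z x i) (e (k - i) y)) = 0.
Proof.
under eq_bigr do rewrite br_suml.
under [X in _ + X + _]eq_bigr do rewrite br_suml.
under [X in _ + X = _]eq_bigr do rewrite br_suml.
rewrite (conv_cycle2 k (fun a b c => br (br (e b y) (e c z)) (e a x))).
rewrite (conv_cycle k (fun a b c => br (br (e c z) (e a x)) (e b y))).
rewrite -!big_split big1 // => i _; rewrite -!big_split big1 // => j _ /=.
exact: jacobi.
Qed.

(** [P] kills the values of [phi], so only the term of order 0 of the deformation survives: an
    element of the graph is recovered from its projection. *)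
Lemma P_deform0 (F : nat -> V) k :
  P (\sum_(i < k.+1) e i (F (k - i)%N)) = P (F k).
Proof. by rewrite (morphD_sum PD) big_ord_recl /= subn0 big1 ?addr0. Qed.

Lemma P_obstruction x y k : P (Omega x y k) = 0.
Proof. by rewrite (morphDB PD) (P_deform0 (fun j => P (W x y j))) PK subrr. Qed.

(** Split [W] into [Omega] and the graph element [e u] with [u = P W]; the bracket of [e u] with
    [e z] is [W] once more, with [u] in place of [x]. *)
Lemma brW_expand x y z k :
  \sum_(i < k.+1) br (W x y i) (e (k - i) z) =
  \sum_(i < k.+1) br (Omega x y i) (e (k - i) z) +
  \sum_(a < k.+1) W (P (W x y a)) z (k - a).
Proof.
pose u a := P (W x y a).
have -> : \sum_(a < k.+1) W (u a) z (k - a) =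
    \sum_(i < k.+1) \sum_(j < i.+1) br (e j (u (i - j)%N)) (e (k - i) z).
  rewrite -(conv_assoc k (fun a b c => br (e b (u a)) (e c z))).
  apply: eq_bigr => i _.
  exact: (conv_rev i (fun a b => br (e b (u a)) (e (k - i) z))).
rewrite -big_split; apply: eq_bigr => i _ /=.
by rewrite -br_suml -brDl /Omega subrK.
Qed.

(** The Bianchi identity, in lowest order. *)
Lemma obstruction_closed x y z N :
  P x = x -> P y = y -> P z = z -> (0 < N)%N ->
  (forall x' y' k, P x' = x' -> P y' = y' -> (k < N)%N -> Omega x' y' k = 0) ->
  let C := fun x y z => br (Omega x y N) z - P (br (Omega x y N) z) +
                        Omega (br x y) z N in
  C x y z + C y z x + C z x y = 0.
Proof.
move=> Px Py Pz N0 Omega0 C.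
pose u x y a := P (W x y a).
(* [A] is the coefficient of [[W(x, y), e z]], and [Q] that of [P [e u, e z]], the base point of its
   graph part. *)
pose Q x y z k := \sum_(a < k.+1) P (W (u x y a) z (k - a)).
pose A x y z k := \sum_(i < k.+1) br (W x y i) (e (k - i) z).
have JA k x' y' z' : A x' y' z' k + A y' z' x' k + A z' x' y' k = 0.
  exact: jacobi_conv.
have PA x' y' z' k : P x' = x' -> P y' = y' -> (k < N)%N -> P (A x' y' z' k) = Q x' y' z' k.
  move=> Px' Py' kN; rewrite /A brW_expand big1 ?add0r; last first.
    move=> i _; rewrite Omega0 ?(leq_ltn_trans _ kN) -1?ltnS //.
    exact: (morphD0 (brDl _)).
  exact: morphD_sum.
(* In order [N], the lower obstructions being zero, [Omega x' y' N] meets only [e 0 z' = z'], and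
   [Omega (u a) z'] survives only for [a = 0], where [u 0 = br x' y'] because the image of [P] is
   closed under [br]. The rest lies in the graph over [Q]. *)
have AN x' y' z' : P x' = x' -> P y' = y' -> P z' = z' ->
    A x' y' z' N = br (Omega x' y' N) z' + Omega (br x' y') z' N +
                   \sum_(i < N.+1) e i (Q x' y' z' (N - i)%N).
  move=> Px' Py' Pz'; rewrite /A brW_expand big_ord_recr /= subnn /=.
  rewrite big1 ?add0r => [|i _]; last by rewrite Omega0 // (morphD0 (brDl _)).
  rewrite -addrA; congr (_ + _).
  rewrite (eq_bigr (fun a : 'I_N.+1 => Omega (u x' y' a) z' (N - a) +
      \sum_(i < (N - a).+1) e i (P (W (u x' y' a) z' (N - a - i))))); last first.
    by move=> a _; rewrite /Omega subrK.
  rewrite big_split /= big_ord_recl subn0; congr (_ + _).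
    rewrite big1 ?addr0; last first.
      move=> i _; apply: Omega0 => //; first by rewrite /u PK.
      by rewrite /= /bump; lia.
    by rewrite /u /W big_ord1 /= P_br.
  rewrite -(conv_assoc N (fun a i c => e i (P (W (u x' y' a) z' c)))).
  rewrite [RHS](eq_bigr (fun i : 'I_N.+1 => \sum_(a < (N - i).+1)
      e i (P (W (u x' y' a) z' (N - i - a))))); last first.
    by move=> i _; rewrite (morphD_sum (@deformD i)).
  rewrite -(conv_assoc N (fun i a c => e i (P (W (u x' y' a) z' c)))).
  apply: eq_bigr => i _.
  exact: (conv_rev i (fun j h => e h (P (W (u x' y' j) z' (N - i))))).
have Q0 k : (k < N)%N -> Q x y z k + Q y z x k + Q z x y k = 0.
  by move=> kN; rewrite -!PA // -!PD JA (morphD0 PD).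
pose S := \sum_(i < N) e i.+1 (Q x y z (N - i.+1)%N + Q y z x (N - i.+1)%N + Q z x y (N - i.+1)%N).
have S0 : S = 0.
  by apply: big1 => i _; rewrite Q0 ?(morphD0 (@deformD _)) //; lia.
(* Subtracting [P A] removes [Q] of order [N], about which [Q0] says nothing; the remaining graph
   terms involve [Q] in orders below [N] only, and their cyclic sum is [S]. *)
have AN' x' y' z' : P x' = x' -> P y' = y' -> P z' = z' ->
    A x' y' z' N - P (A x' y' z' N) = C x' y' z' +
       \sum_(i < N) e i.+1 (Q x' y' z' (N - i.+1)%N).
  move=> Px' Py' Pz'; rewrite AN // 2!PD P_obstruction addr0 (P_deform0 (Q x' y' z')).
  have -> : P (Q x' y' z' N) = Q x' y' z' N.
    by rewrite (morphD_sum PD); apply: eq_bigr => i _.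
  rewrite big_ord_recl subn0 /= /C.
  set a := br _ _; set b := Omega _ _ _; set c := Q _ _ _ _; set d := \sum_(i < _) _.
  by rewrite [c + d]addrC addrA [P a + c]addrC addrKA addrAC [a + b - _]addrAC.
have := JA N x y z => /[dup] J; move/(congr1 P); rewrite (morphD0 PD) 2!PD => PJ.
pose T x y z := \sum_(i < N) e i.+1 (Q x y z (N - i.+1)%N).
have ST : T x y z + T y z x + T z x y = 0.
  by rewrite -S0 /S -!big_split /=; apply: eq_bigr => i _; rewrite !phiD.
have CE x' y' z' : P x' = x' -> P y' = y' -> P z' = z' ->
    C x' y' z' = A x' y' z' N - P (A x' y' z' N) - T x' y' z'.
  by move=> Px' Py' Pz'; rewrite AN' // addrK.
rewrite !CE // ![_ - T _ _ _ + (_ - T _ _ _)]addrACA -!opprD.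
rewrite [_ - (T _ _ _ + _) + _]addrACA -opprD ST subr0.
by rewrite (addrACA (A x y z N)) (addrACA _ _ (A z x y N)) -!opprD J PJ subr0.
Qed.

Context (P_br_phi : forall j k x y, P (br (phi j x) (phi k y)) = 0).

(** [dbar] in degree one, with [v - P v] standing for the [T']-component of [v]. *)
Definition dbar1 k x y :=
  (br x (phi k y) - P (br x (phi k y))) - (br y (phi k x) - P (br y (phi k x)))
  - phi k (br x y).

Definition bracket1 m h x y :=
  br (phi m x) (phi h y) + br (phi h x) (phi m y)
  - phi m (P (br x (phi h y)) + P (br (phi h x) y))
  - phi h (P (br (phi m x) y) + P (br x (phi m y))).

(** The terms of [Omega] containing [phi 0 = 1] make up [dbar1]. The others form half of each
    bracket: [bracket1 m h] is such a term plus the same term with [m] and [h] exchanged, hence the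
    doubling. *)
Lemma obstructionE k x y : P x = x -> P y = y -> (0 < k)%N ->
  Omega x y k *+ 2 =
  dbar1 k x y *+ 2 + \sum_(1 <= m < k) bracket1 m (k - m)%N x y.
Proof.
move=> Px Py; case: k => // k _.
pose p j := P (br x (phi j y)) + P (br (phi j x) y).
pose q m j := br (phi m x) (phi j y).
have sumE j (F : nat -> V) :
    \sum_(i < j.+2) F i = F 0 + \sum_(1 <= i < j.+1) F i + F j.+1.
  rewrite -(big_mkord predT F) big_ltn // big_nat_recr //=.
  by rewrite addrA.
have WS j : W x y j.+1 =
   br x (phi j.+1 y) + \sum_(1 <= i < j.+1) q i (j.+1 - i)%N + br (phi j.+1 x) y.
  rewrite /W (sumE _ (fun i => br (e i x) (e (j.+1 - i) y))) subn0 subnn /=.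
  congr (_ + _ + _); apply: eq_big_nat => i /andP[i0 ij].
  by rewrite /q; case: i i0 ij => // i _ ij; rewrite subSn.
(* Brackets of two values of [phi] have no [E]-component, so the projection of [W] is linear in
   [phi]. Otherwise the obstruction would have cubic terms. *)
have PWS j : P (W x y j.+1) = p j.+1.
  rewrite WS 2!PD (morphD_sum PD) [X in _ + X + _]big1 ?addr0 // => i _.
  exact: P_br_phi.
have OmegaE : Omega x y k.+1 = dbar1 k.+1 x y +
    (\sum_(1 <= i < k.+1) q i (k.+1 - i)%N -
     \sum_(1 <= i < k.+1) phi i (p (k.+1 - i)%N)).
  rewrite /Omega (sumE _ (fun i => e i (P (W x y (k.+1 - i))))) subn0 subnn.
  rewrite (eq_big_nat _ _ (F2 := fun i => phi i (p (k.+1 - i)%N))); last first.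
    case=> // i ik; rewrite (_ : k.+1 - i.+1 = (k - i.+1).+1)%N; last by lia.
    by rewrite PWS.
  rewrite [e 0 _]/= PWS WS /W big_ord1 /= P_br // /dbar1 /p.
  rewrite [br y _]brC (morphDN PD) opprK.
  set a := br x _; set b := br _ y; set c := \sum_(_ <= _ < _) _.
  set d := \sum_(_ <= _ < _) _; set z := phi _ _; set a' := P a; set b' := P b.
  have -> : a - a' - (- b + b') = a + b - (a' + b').
    by rewrite !opprD opprK addrACA.
  rewrite (addrAC a c b) [a' + b' + d + z]addrAC opprD addrACA.
  by congr (_ + _); rewrite opprD addrA.
rewrite OmegaE mulrnDl; congr (_ + _).
(* The second sum is the first one with [m] replaced by [k.+1 - m]. *)
have -> : \sum_(1 <= m < k.+1) bracket1 m (k.+1 - m)%N x y =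
  \sum_(1 <= m < k.+1) (q m (k.+1 - m)%N - phi m (p (k.+1 - m)%N)) +
  \sum_(1 <= m < k.+1) (q (k.+1 - m)%N m - phi (k.+1 - m)%N (p m)).
  rewrite -big_split; apply: eq_bigr => m _ /=; rewrite /bracket1 /q /p.
  by rewrite [P (br (phi m x) y) + _]addrC addrACA -opprD opprD !addrA.
rewrite [X in _ = _ + X]big_nat_rev /= -sumrB mulr2n; congr (_ + _).
apply: eq_big_nat => i /andP[i1 ik].
by rewrite (_ : 1 + k.+1 - i.+1 = k.+1 - i)%N ?subKn ?(ltnW ik) //; lia.
Qed.

(** As [phi l.+1 = 0], the sum [beta] is twice the obstruction of order [l.+1], to which
    [obstruction_closed] applies with [N = l.+1]. The obstruction of order 0 vanishes by [P_br], the
    orders 1 to [l] by the Maurer-Cartan equations. *)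
Theorem maurer_cartan_step l x y z :
  (forall v : V, v *+ 2 = 0 -> v = 0) -> (forall v, phi l.+1 v = 0) ->
  (forall k x y, (0 < k <= l)%N -> P x = x -> P y = y ->
     dbar1 k x y *+ 2 + \sum_(1 <= m < k) bracket1 m (k - m)%N x y = 0) ->
  P x = x -> P y = y -> P z = z ->
  let beta := fun x y => \sum_(1 <= m < l.+1) bracket1 m (l.+1 - m)%N x y in
  let C := fun x y z => br (beta x y) z - P (br (beta x y) z) + beta (br x y) z in
  C x y z + C y z x + C z x y = 0.
Proof.
move=> V2 phiN MC Px Py Pz beta C.
have Omega0 x' y' k : P x' = x' -> P y' = y' -> (k < l.+1)%N -> Omega x' y' k = 0.
  move=> Px' Py'; case: k => [_|k kl].
    by rewrite /Omega /W !big_ord1 /= P_br // subrr.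
  by apply: V2; rewrite obstructionE // MC.
have betaE x' y' : P x' = x' -> P y' = y' -> beta x' y' = Omega x' y' l.+1 *+ 2.
  move=> Px' Py'; rewrite obstructionE // /dbar1 !phiN.
  by rewrite !(morphD0 (brDr _)) (morphD0 PD) !subr0 mul0rn add0r.
pose C' x y z := br (Omega x y l.+1) z - P (br (Omega x y l.+1) z) + Omega (br x y) z l.+1.
have CE x' y' z' : P x' = x' -> P y' = y' -> P z' = z' -> C x' y' z' = C' x' y' z' *+ 2.
  move=> Px' Py' Pz'; have Pxy := P_br Px' Py'.
  rewrite /C (betaE x' y') // (betaE (br x' y')) // !mulr2n brDl PD opprD.
  by rewrite (addrACA (br (Omega x' y' _) z')) [LHS]addrACA.
by rewrite !CE // -!mulrnDl (obstruction_closed Px Py Pz _ Omega0) ?mul0rn.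
Qed.

Lemma bracket1C m h x y : bracket1 m h y x = - bracket1 m h x y.
Proof.
rewrite /bracket1 [br (phi m y) _]brC [br (phi h y) (phi m x)]brC.
rewrite [br y (phi h x)]brC [br (phi h y) x]brC [br (phi m y) x]brC [br y (phi m x)]brC.
rewrite !(morphDN PD) ![phi _ (- _ - _)]phiD !(morphDN (@phiD _)) !opprD !opprK !phiD.
by congr (_ + _ + _); rewrite addrC.
Qed.

Lemma bracket1Nl m h x y : bracket1 m h (- x) y = - bracket1 m h x y.
Proof.
rewrite /bracket1 !(morphDN (@phiD _)) !(morphDN (brDl _)) !(morphDN PD).
by rewrite ![phi _ (- _ - _)]phiD !(morphDN (@phiD _)) !phiD !opprD !opprK.
Qed.

(** The alternating sum of the degree-two [dbar] is the opposite of the cyclic sum of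
    [maurer_cartan_step], by antisymmetry of [br] and of [beta]. *)
Corollary maurer_cartan_step_dbar l x y z :
  (forall v : V, v *+ 2 = 0 -> v = 0) -> (forall v, phi l.+1 v = 0) ->
  (forall k x y, (0 < k <= l)%N -> P x = x -> P y = y ->
     dbar1 k x y *+ 2 + \sum_(1 <= m < k) bracket1 m (k - m)%N x y = 0) ->
  P x = x -> P y = y -> P z = z ->
  let beta := fun x y => \sum_(1 <= m < l.+1) bracket1 m (l.+1 - m)%N x y in
  (br x (beta y z) - P (br x (beta y z))) - (br y (beta x z) - P (br y (beta x z)))
  + (br z (beta x y) - P (br z (beta x y)))
  - beta (br x y) z + beta (br x z) y - beta (br y z) x = 0.
Proof.
move=> V2 phiN MC Px Py Pz beta.
have := maurer_cartan_step V2 phiN MC Px Py Pz; rewrite -/beta /=.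
have betaC a b : beta b a = - beta a b.
  by rewrite /beta -sumrN; apply: eq_bigr => i _; exact: bracket1C.
have betaNl a b : beta (- a) b = - beta a b.
  by rewrite /beta -sumrN; apply: eq_bigr => i _; exact: bracket1Nl.
rewrite (betaC x z) [br z x]brC (betaNl (br x z)) (morphDN (brDl y)).
rewrite [br (beta x y) z]brC [br (beta y z) x]brC [br (beta x z) y]brC.
rewrite !(morphDN PD) !opprK => eq0; apply: oppr_inj; rewrite oppr0 -[RHS]eq0.
move: (br x _) (br y _) (br z _) (P (br x _)) (P (br y _)) (P (br z _)) => a b c a' b' c'.
move: (beta _ z) (beta _ y) (beta _ x) => d e' f.
rewrite !opprD !opprK.
move: (- a + a') (b - b') (- c + c') => u v w.
by rewrite [LHS](AC 6 (3*4*(1*6)*(2*5)))%AC.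
Qed.

End Deformation.

(** * Functions of class C^k *)

Section CkTheory.
Context {R : realType} {m : nat}.
Implicit Types (D : set 'rV[R]_m) (f g : 'rV[R]_m -> R).

Lemma open_near_eq (T : topologicalType) (V : Type) (D : set T) (f g : T -> V) x :
  open D -> D x -> (forall y, D y -> f y = g y) -> \forall y \near x, f y = g y.
Proof. by move=> oD Dx fg; apply: filterS (open_nbhs_nbhs (conj oD Dx)). Qed.

Lemma continuous_near_eq (f g : 'rV[R]_m -> R) x :
  (\forall y \near x, f y = g y) -> {for x, continuous f} -> {for x, continuous g}.
Proof.
move=> fg cf; rewrite /prop_for /continuous_at -(nbhs_singleton fg).
exact: cvg_trans (near_eq_cvg fg) cf.
Qed.

Lemma CkS k D f : Ck k.+1 D f -> Ck k D f.
Proof.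
elim: k f => [|k IH] f /= [cf df]; split=> // i; split; first by case: (df i).
by apply: IH; case: (df i).
Qed.

Lemma Ck_ext k D f g : open D -> (forall x, D x -> f x = g x) ->
  Ck k D f -> Ck k D g.
Proof.
move=> oD; elim: k f g => [|k IH] f g fg /= [cf df].
  split=> // x /[dup] /set_mem Dx xD.
  by apply: continuous_near_eq (cf _ xD); apply: (open_near_eq oD).
split=> [x /[dup] /set_mem Dx xD|i].
  by apply: continuous_near_eq (cf _ xD); apply: (open_near_eq oD).
have [dfi Cf] := df i; split.
  by move=> x Dx; apply: near_eq_derivable (dfi x Dx); apply: (open_near_eq oD).
apply: IH Cf => x Dx; apply: near_eq_derive.
exact: (open_near_eq oD).
Qed.

(** [Ck k D f] is a conjunction of conditions at the single points of [D], since [f] and its partial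
    derivatives are functions on the whole space. *)
Lemma Ck_local k D f : (forall x, D x -> exists2 D', D' x & Ck k D' f) -> Ck k D f.
Proof.
elim: k f => [|k IH] f loc /=.
  by split=> // x /set_mem /loc [D' D'x [cf _]]; apply: cf; rewrite inE.
split=> [x /set_mem /loc [D' D'x [cf _]]|i]; first by apply: cf; rewrite inE.
split=> [x /loc [D' D'x /= [_ df]]|]; first by case: (df i) => + _; apply.
by apply: IH => x /loc [D' D'x /= [_ df]]; exists D' => //; case: (df i).
Qed.

Lemma Ck_sub k D D' f : D' `<=` D -> Ck k D f -> Ck k D' f.
Proof. by move=> sub Cf; apply: Ck_local => x /sub Dx; exists D. Qed.

Lemma Ck_cst k D c : Ck k D (cst c).
Proof.
elim: k c => [|k IH] c /=; first by split=> // x _; exact: cst_continuous.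
split=> [x _|i]; first exact: cst_continuous.
split=> [x _|]; first exact: derivable_cst.
rewrite (_ : partial _ i = cst 0) //.
by apply/funext => x; rewrite /partial derive_cst.
Qed.

Lemma Ck_cont k D f x : D x -> Ck k D f -> {for x, continuous f}.
Proof. by move=> Dx; case: k => [|k] [cf _]; apply: cf; rewrite inE. Qed.

Lemma CkD k D f g : open D -> Ck k D f -> Ck k D g -> Ck k D (fun x => f x + g x).
Proof.
move=> oD; elim: k f g => [|k IH] f g /= [cf df] [cg dg].
  by split=> // x xD; exact: cvgD (cf _ xD) (cg _ xD).
split=> [x xD|i]; first by exact: cvgD (cf _ xD) (cg _ xD).
have [dfi Cf] := df i; have [dgi Cg] := dg i; split=> [x Dx|].
  by apply: derivableD; [exact: dfi|exact: dgi].
apply: Ck_ext (IH _ _ Cf Cg) => // x Dx.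
by rewrite /partial deriveD; [|exact: dfi|exact: dgi].
Qed.

Lemma CkM k D f g : open D -> Ck k D f -> Ck k D g -> Ck k D (fun x => f x * g x).
Proof.
move=> oD; elim: k f g => [|k IH] f g.
  by move=> /= [cf _] [cg _]; split=> // x xD; exact: cvgM (cf _ xD) (cg _ xD).
move=> Cf Cg; have Cf' := CkS Cf; have Cg' := CkS Cg.
move: Cf Cg => /= [cf df] [cg dg].
split=> [x xD|i]; first by exact: cvgM (cf _ xD) (cg _ xD).
have [dfi Cfi] := df i; have [dgi Cgi] := dg i; split=> [x Dx|].
  by apply: derivableM; [exact: dfi|exact: dgi].
apply: Ck_ext (CkD oD (IH _ _ Cf' Cgi) (IH _ _ Cg' Cfi)) => // x Dx.
by rewrite /partial deriveM; [|exact: dfi|exact: dgi].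
Qed.

Lemma CkV k D f : open D -> (forall x, D x -> f x != 0) -> Ck k D f ->
  Ck k D (fun x => (f x)^-1).
Proof.
move=> oD f0; elim: k => [|k IH] Cf.
  by split=> // x /set_mem Dx; exact: cvgV (f0 _ Dx) (Ck_cont Dx Cf).
have Cf' := IH (CkS Cf).
split=> [x /set_mem Dx|i]; first by exact: cvgV (f0 _ Dx) (Ck_cont Dx Cf).
have [dfi Cfi] := (Cf.2 i); split=> [x Dx|].
  by apply: derivableV; [exact: f0|exact: dfi].
apply: Ck_ext (CkM oD (Ck_cst k D (-1)) (CkM oD (CkM oD Cf' Cf') Cfi)) => // x Dx.
rewrite /partial deriveV; [|exact: f0|exact: dfi].
by rewrite /cst mulN1r scaleNr -exprVn expr2.
Qed.

Lemma partial_coord (i j : 'I_m) (x : 'rV[R]_m) :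
  derivable (fun y : 'rV[R]_m => y ord0 i) x (delta_mx ord0 j) /\
  partial (fun y => y ord0 i) j x = (i == j)%:R.
Proof.
split; first by apply: diff_derivable; exact: differentiable_coord.
rewrite /partial /derive; apply: cvg_lim => //.
apply: cvg_near_cst; near=> h.
rewrite /= !mxE addrK eqxx /= /GRing.scale /= mulKf //.
by near: h; exact: nbhs_dnbhs_neq.
Unshelve. all: by end_near.
Qed.

End CkTheory.

(** * Symmetry of second derivatives *)

Section SchwarzTheorem.
Context {R : realType} {m : nat}.
Implicit Types (D : set 'rV[R]_m) (f g : 'rV[R]_m -> R).

Lemma is_derive_line f (v y : 'rV[R]_m) (s : R) : derivable f (s *: v + y) v ->
  is_derive s 1 (fun t => f (t *: v + y)) ('D_v f (s *: v + y)).
Proof.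
have E : (fun h : R => h^-1 *: (((fun t => f (t *: v + y)) \o shift s) (h *: 1) -
      f (s *: v + y))) =
    (fun h : R => h^-1 *: ((f \o shift (s *: v + y)) (h *: v) - f (s *: v + y))).
  by apply/funext => h /=; rewrite [h *: 1]mulr1 scalerDl addrA.
by move=> df; split; rewrite /derivable /derive E.
Qed.

(** Two uses of the mean value theorem: along [u] for the increment of [f] by [h *: v], then along
    [v] for [partial f i]. *)
Lemma second_difference D f i j (x : 'rV[R]_m) (h : R) : 0 < h -> Ck 2 D f ->
  let u := delta_mx ord0 i in let v := delta_mx ord0 j in
  (forall s t : R, 0 <= s <= h -> 0 <= t <= h -> D (s *: u + (t *: v + x))) ->
  exists s t : R, [/\ 0 <= s <= h, 0 <= t <= h &
   f (h *: u + (h *: v + x)) - f (h *: u + x) - f (h *: v + x) + f x =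
   partial (partial f i) j (s *: u + (t *: v + x)) * h * h].
Proof.
move=> h0 [_ C2] u v Dx; have [di [_ C1]] := C2 i; have [dij _] := C1 j.
have hh : 0 <= h <= h by rewrite lexx ltW.
have h00 : 0 <= (0 : R) <= h by rewrite lexx ltW.
have Dx0 s : 0 <= s <= h -> D (s *: u + x).
  by move=> sh; have := Dx s 0 sh h00; rewrite scale0r add0r.
have Dg (s : R) : s \in `[0, h] ->
    is_derive s 1 (fun s => f (s *: u + (h *: v + x)) - f (s *: u + x))
      (partial f i (s *: u + (h *: v + x)) - partial f i (s *: u + x)).
  rewrite in_itv /= => sh; apply: is_deriveB.
    by apply: is_derive_line; apply: di; exact: Dx.
  by apply: is_derive_line; apply: di; exact: Dx0.
have [s sh Es] := MVT h0 (fun s sh => Dg s (subset_itv_oo_cc sh))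
  (derivable_within_continuous (fun s sh => @ex_derive _ _ _ _ _ _ _ (Dg s sh))).
have sh' : 0 <= s <= h by have := subset_itv_oo_cc sh; rewrite in_itv.
have Dk (t : R) : t \in `[0, h] ->
    is_derive t 1 (fun t => partial f i (t *: v + (s *: u + x)))
      (partial (partial f i) j (t *: v + (s *: u + x))).
  rewrite in_itv /= => th; apply: is_derive_line; apply: dij.
  by rewrite addrCA; exact: Dx.
have [t th Et] := MVT h0 (fun t th => Dk t (subset_itv_oo_cc th))
  (derivable_within_continuous (fun t th => @ex_derive _ _ _ _ _ _ _ (Dk t th))).
have th' : 0 <= t <= h by have := subset_itv_oo_cc th; rewrite in_itv.
exists s, t; split=> //.
move: Es Et; rewrite /= !subr0 !scale0r !add0r => Es Et.
by rewrite opprB addrA in Es; rewrite [LHS]addrAC Es addrCA Et addrCA.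
Qed.

Lemma ball_close D (G1 G2 : 'rV[R]_m -> R) (x : 'rV[R]_m) (e : R) :
  open D -> D x -> 0 < e -> {for x, continuous G1} -> {for x, continuous G2} ->
  exists2 r : R, 0 < r & forall y, ball x r y ->
    [/\ D y, `|G1 x - G1 y| < e & `|G2 x - G2 y| < e].
Proof.
move=> oD Dx e0 /cvgr_dist_lt/(_ _ e0) near1 /cvgr_dist_lt/(_ _ e0) near2.
suff /nbhs_ballP : nbhs x [set y | [/\ D y, `|G1 x - G1 y| < e & `|G2 x - G2 y| < e]].
  by [].
apply: filterS3 (open_nbhs_nbhs (conj oD Dx)) near1 near2 => y.
by split.
Qed.

Lemma dist_split (a b c e : R) :
  `|a - c| < e / 2 -> `|b - c| < e / 2 -> `|a - b| <= e.
Proof.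
rewrite !ltr_norml ler_norml => /andP[? ?] /andP[? ?].
by apply/andP; split; lra.
Qed.

(** The second difference does not depend on the order of the two directions, so each mixed
    derivative takes the same value at some point near [x]; continuity of both brings these values
    back to [x] up to [e]. *)
Lemma schwarz D f i j (x : 'rV[R]_m) : open D -> D x -> Ck 2 D f ->
  partial (partial f i) j x = partial (partial f j) i x.
Proof.
move=> oD Dx C2; apply/eqP; rewrite -subr_eq0 -normr_le0; apply/ler_addgt0Pr => e e0.
rewrite add0r.
have cij i' j' : {for x, continuous (partial (partial f i') j')}.
  by have [_ /(_ i')[_ [_ /(_ j') [_ [+ _]]]]] := C2; apply; rewrite inE.
have [|r r0 ball_r] := ball_close oD Dx _ (cij i j) (cij j i) (e := e / 2).
  by rewrite divr_gt0.
pose u : 'rV[R]_m := delta_mx ord0 i; pose v : 'rV[R]_m := delta_mx ord0 j.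
(* With this choice [h * K = r / 2], so the parallelogram of side parameters up to [h] stays inside
   the ball of radius [r]. *)
pose K := 1 + `|u| + `|v|; pose h := r / 2 / K.
have K0 : 0 < K by rewrite /K -addrA ltr_pwDl // addr_ge0.
have h0 : 0 < h by rewrite !divr_gt0.
have small s t : 0 <= s <= h -> 0 <= t <= h -> ball x r (s *: u + (t *: v + x)).
  move=> /andP[s0 sh] /andP[t0 th]; rewrite -ball_normE /= addrA opprD addrCA subrr addr0.
  rewrite normrN (le_lt_trans (ler_normD _ _)) // !normrZ !ger0_norm //.
  have : s * `|u| + t * `|v| <= h * K.
    rewrite /K !mulrDr -addrA; apply: ler_wpDl; first by rewrite mulr1 ltW.
    by apply: lerD; apply: ler_wpM2r.
  by move/le_lt_trans; apply; rewrite /h divfK ?gt_eqF // ltr_pdivrMr //; lra.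
have Dij s t : 0 <= s <= h -> 0 <= t <= h -> D (s *: u + (t *: v + x)).
  by move=> sh th; case: (ball_r _ (small s t sh th)).
have Dji t s : 0 <= t <= h -> 0 <= s <= h -> D (t *: v + (s *: u + x)).
  by move=> th sh; rewrite addrCA; exact: Dij.
have [s [t [sh th E1]]] := second_difference h0 C2 Dij.
have [t' [s' [th' sh' E2]]] := second_difference h0 C2 Dji.
have [_ F1 _] := ball_r _ (small s t sh th).
have ball2 : ball x r (t' *: v + (s' *: u + x)) by rewrite addrCA; exact: small.
have [_ _ F2] := ball_r _ ball2.
have symm : f (h *: u + (h *: v + x)) - f (h *: u + x) - f (h *: v + x) + f x =
            f (h *: v + (h *: u + x)) - f (h *: v + x) - f (h *: u + x) + f x.
  by rewrite [h *: u + (_ + _)]addrCA; congr (_ + _); rewrite addrAC.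
have EE : partial (partial f i) j (s *: u + (t *: v + x)) =
          partial (partial f j) i (t' *: v + (s' *: u + x)).
  apply: (@mulIf _ h); first by rewrite gt_eqF.
  apply: (@mulIf _ h); first by rewrite gt_eqF.
  exact: etrans (esym E1) (etrans symm E2).
rewrite -EE in F2.
exact: dist_split F1 F2.
Qed.
End SchwarzTheorem.

(** * Smooth complex-valued functions of real coordinates *)

Section ComplexSmooth.
Context {R : realType} {m : nat}.
Local Notation C := R[i].
Implicit Types (D : set 'rV[R]_m) (F G : 'rV[R]_m -> C).

(** Stated so that [smooth] unfolds to it in each chart, as [coord_partial] does to [cpartial]. *)
Definition cCinfty D F : Prop :=
  Cinfty D (fun x => complex.Re (F x)) /\ Cinfty D (fun x => complex.Im (F x)).

Definition cpartial F (i : 'I_m) (x : 'rV[R]_m) : C :=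
  partial (fun y => complex.Re (F y)) i x +i* partial (fun y => complex.Im (F y)) i x.

Lemma ReD (z w : C) : complex.Re (z + w) = complex.Re z + complex.Re w.
Proof. by case: z; case: w. Qed.
Lemma ImD (z w : C) : complex.Im (z + w) = complex.Im z + complex.Im w.
Proof. by case: z; case: w. Qed.
Lemma ReM (z w : C) : complex.Re (z * w) =
  complex.Re z * complex.Re w - complex.Im z * complex.Im w.
Proof. by case: z; case: w. Qed.
Lemma ImM (z w : C) : complex.Im (z * w) =
  complex.Re z * complex.Im w + complex.Im z * complex.Re w.
Proof. by case: z; case: w. Qed.
Lemma ReJ (z : C) : complex.Re (z^*) = complex.Re z.
Proof. by case: z. Qed.
Lemma ImJ (z : C) : complex.Im (z^*) = - complex.Im z.
Proof. by case: z. Qed.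

Lemma Cinfty_ext D f g : open D -> (forall x, D x -> f x = g x) ->
  Cinfty D f -> Cinfty D g.
Proof. by move=> oD fg Cf k; apply: Ck_ext (Cf k). Qed.

Lemma CinftyN D (f : 'rV[R]_m -> R) : open D -> Cinfty D f -> Cinfty D (fun x => - f x).
Proof.
move=> oD Cf k; apply: Ck_ext (CkM oD (Ck_cst k D (-1)) (Cf k)) => // x _.
by rewrite /cst mulN1r.
Qed.

Lemma Cinfty_partial D (f : 'rV[R]_m -> R) i : Cinfty D f -> Cinfty D (partial f i).
Proof. by move=> Cf k; case: (Cf k.+1) => _ /(_ i) []. Qed.

Lemma Cinfty_derivable D (f : 'rV[R]_m -> R) i x : D x -> Cinfty D f ->
  derivable f x (delta_mx ord0 i).
Proof. by move=> Dx Cf; case: (Cf 1%N) => _ /(_ i) [+ _]; apply. Qed.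

Lemma cCinfty_ext D F G : open D -> (forall x, D x -> F x = G x) ->
  cCinfty D F -> cCinfty D G.
Proof.
by move=> oD FG [CR CI]; split; [apply: Cinfty_ext CR|apply: Cinfty_ext CI] => // x /FG ->.
Qed.

Lemma cCinfty_local D F : (forall x, D x -> exists2 D', D' x & cCinfty D' F) -> cCinfty D F.
Proof.
move=> loc; split=> k; apply: Ck_local => x /loc [D' D'x [CR CI]]; exists D' => //.
Qed.

Lemma cCinfty_sub D D' F : D' `<=` D -> cCinfty D F -> cCinfty D' F.
Proof. by move=> sub [CR CI]; split=> k; apply: Ck_sub sub _. Qed.

Lemma cCinfty_cst D (c : C) : cCinfty D (fun=> c).
Proof. by split=> k; apply: Ck_cst. Qed.

Lemma cCinftyD D F G : open D -> cCinfty D F -> cCinfty D G ->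
  cCinfty D (fun x => F x + G x).
Proof.
move=> oD [FR FI] [GR GI]; split=> k.
  by apply: Ck_ext (CkD oD (FR k) (GR k)) => // x _; rewrite ReD.
by apply: Ck_ext (CkD oD (FI k) (GI k)) => // x _; rewrite ImD.
Qed.

Lemma cCinftyM D F G : open D -> cCinfty D F -> cCinfty D G ->
  cCinfty D (fun x => F x * G x).
Proof.
move=> oD [FR FI] [GR GI]; split=> k.
  apply: Ck_ext (CkD oD (CkM oD (FR k) (GR k))
    (CkM oD (CinftyN oD FI k) (GI k))) => // x _.
  by rewrite ReM mulNr.
apply: Ck_ext (CkD oD (CkM oD (FR k) (GI k)) (CkM oD (FI k) (GR k))) => // x _.
by rewrite ImM.
Qed.

Lemma cCinfty_conj D F : open D -> cCinfty D F -> cCinfty D (fun x => (F x)^*).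
Proof.
move=> oD [FR FI]; split; first by apply: Cinfty_ext FR => // x _; rewrite ReJ.
by apply: Cinfty_ext (CinftyN oD FI) => // x _; rewrite ImJ.
Qed.

Lemma cCinftyV D F : open D -> (forall x, D x -> F x != 0) -> cCinfty D F ->
  cCinfty D (fun x => (F x)^-1).
Proof.
move=> oD F0 [FR FI].
(* The inverse of [F] is its conjugate divided by the squared modulus [N], which reduces the claim
   to inverting a real function. *)
pose N x := complex.Re (F x) * complex.Re (F x) + complex.Im (F x) * complex.Im (F x).
have N0 x : D x -> N x != 0.
  move=> Dx; apply: contra (F0 _ Dx); rewrite /N; case: (F x) => a b /=.
  rewrite -!expr2 paddr_eq0 ?sqr_ge0 // !sqrf_eq0 => /andP[/eqP -> /eqP ->].
  by [].
have CN k : Ck k D (fun x => (N x)^-1).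
  exact: CkV oD N0 (CkD oD (CkM oD (FR k) (FR k)) (CkM oD (FI k) (FI k))).
split=> k.
  apply: Ck_ext (CkM oD (FR k) (CN k)) => // x Dx.
  by rewrite /N; case: (F x) => a b /=; rewrite !expr2.
apply: Ck_ext (CkM oD (CinftyN oD FI k) (CN k)) => // x Dx.
by rewrite /N; case: (F x) => a b /=; rewrite !expr2 mulNr.
Qed.

Lemma cCinfty_partial D F i : cCinfty D F -> cCinfty D (cpartial F i).
Proof. by move=> [FR FI]; split; apply: Cinfty_partial. Qed.

Lemma cpartial_near_eq F G i x : (\forall y \near x, F y = G y) ->
  cpartial F i x = cpartial G i x.
Proof.
move=> FG; rewrite /cpartial /partial.
by congr (_ +i* _); apply: near_eq_derive; apply: filterS FG => y ->.
Qed.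

Lemma cpartial_cst i (c : C) x : cpartial (fun=> c) i x = 0.
Proof. by rewrite /cpartial /partial !derive_cst. Qed.

Lemma cpartialD D F G i x : D x -> cCinfty D F -> cCinfty D G ->
  cpartial (fun y => F y + G y) i x = cpartial F i x + cpartial G i x.
Proof.
move=> Dx [FR FI] [GR GI]; rewrite /cpartial /partial.
rewrite (_ : (fun y => complex.Re (F y + G y)) =
  (fun y => complex.Re (F y)) + (fun y => complex.Re (G y))); last first.
  by apply/funext => y; rewrite ReD.
rewrite (_ : (fun y => complex.Im (F y + G y)) =
  (fun y => complex.Im (F y)) + (fun y => complex.Im (G y))); last first.
  by apply/funext => y; rewrite ImD.
by rewrite !deriveD //; apply: (Cinfty_derivable Dx).
Qed.

Lemma cpartial_conj D F i x : D x -> cCinfty D F ->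
  cpartial (fun y => (F y)^*) i x = (cpartial F i x)^*.
Proof.
move=> Dx [FR FI]; rewrite /cpartial /partial.
rewrite (_ : (fun y => complex.Re (F y)^*) = (fun y => complex.Re (F y))); last first.
  by apply/funext => y; rewrite ReJ.
rewrite (_ : (fun y => complex.Im (F y)^*) = - (fun y => complex.Im (F y))); last first.
  by apply/funext => y; rewrite ImJ.
by rewrite deriveN //; apply: (Cinfty_derivable Dx).
Qed.

(** The left side is the shape in which the real Leibniz rule delivers the real and imaginary parts
    in [cpartialM]. *)
Lemma complex_leibniz (z w : C) (a b c d : R) :
  (complex.Re z *: c + complex.Re w *: a - (complex.Im z *: d + complex.Im w *: b)) +i*
  (complex.Re z *: d + complex.Im w *: a + (complex.Im z *: c + complex.Re w *: b)) =
  z * (c +i* d) + (a +i* b) * w.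
Proof.
rewrite /GRing.scale /=; case: z w => z1 z2 [w1 w2] /=; apply/eqP.
by rewrite eq_complex /=; apply/andP; split; apply/eqP; ring.
Qed.

Lemma cpartialM D F G i x : D x -> cCinfty D F -> cCinfty D G ->
  cpartial (fun y => F y * G y) i x = F x * cpartial G i x + cpartial F i x * G x.
Proof.
move=> Dx [FR FI] [GR GI]; rewrite /cpartial /partial.
rewrite (_ : (fun y => complex.Re (F y * G y)) =
  (fun y => complex.Re (F y)) * (fun y => complex.Re (G y)) -
  (fun y => complex.Im (F y)) * (fun y => complex.Im (G y))); last first.
  by apply/funext => y; rewrite ReM.
rewrite (_ : (fun y => complex.Im (F y * G y)) =
  (fun y => complex.Re (F y)) * (fun y => complex.Im (G y)) +
  (fun y => complex.Im (F y)) * (fun y => complex.Re (G y))); last first.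
  by apply/funext => y; rewrite ImM.
have dFR := Cinfty_derivable (i := i) Dx FR; have dFI := Cinfty_derivable (i := i) Dx FI.
have dGR := Cinfty_derivable (i := i) Dx GR; have dGI := Cinfty_derivable (i := i) Dx GI.
rewrite (deriveB (derivableM dFR dGR) (derivableM dFI dGI)).
rewrite (deriveD (derivableM dFR dGI) (derivableM dFI dGR)).
rewrite (deriveM dFR dGR) (deriveM dFI dGI) (deriveM dFR dGI) (deriveM dFI dGR).
exact: complex_leibniz.
Qed.

Lemma cCinfty_sum (I : Type) (r : seq I) D (F : I -> 'rV[R]_m -> C) : open D ->
  (forall i, cCinfty D (F i)) -> cCinfty D (fun x => \sum_(i <- r) F i x).
Proof.
move=> oD CF; elim: r => [|i r IH].
  by apply: cCinfty_ext (cCinfty_cst D 0) => // x _; rewrite big_nil.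
by apply: cCinfty_ext (cCinftyD oD (CF i) IH) => // x _; rewrite big_cons.
Qed.

Lemma cpartial_sum (I : Type) (r : seq I) D (F : I -> 'rV[R]_m -> C) i x :
  open D -> D x -> (forall j, cCinfty D (F j)) ->
  cpartial (fun y => \sum_(j <- r) F j y) i x = \sum_(j <- r) cpartial (F j) i x.
Proof.
move=> oD Dx CF; elim: r => [|j r IH].
  rewrite big_nil -[RHS](cpartial_cst i 0 x); congr (cpartial _ i x).
  by apply/funext => y; rewrite big_nil.
rewrite big_cons -IH -(cpartialD i Dx (CF j) (cCinfty_sum r oD CF)).
by congr (cpartial _ i x); apply/funext => y; rewrite big_cons.
Qed.

Lemma cpartialC D F i j x : open D -> D x -> cCinfty D F ->
  cpartial (cpartial F i) j x = cpartial (cpartial F j) i x.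
Proof.
move=> oD Dx [FR FI]; rewrite /cpartial /=.
exact: (f_equal2 (@Complex R) (schwarz i j oD Dx (FR 2%N)) (schwarz i j oD Dx (FI 2%N))).
Qed.

(** The second-order terms of the two compositions cancel by [cpartialC], so the commutator is again
    a first-order operator. *)
Lemma commutator_partial D (A B : 'I_m -> 'rV[R]_m -> C) F x :
  open D -> D x -> (forall i, cCinfty D (A i)) -> (forall i, cCinfty D (B i)) ->
  cCinfty D F ->
  \sum_i A i x * cpartial (fun y => \sum_j B j y * cpartial F j y) i x -
  \sum_i B i x * cpartial (fun y => \sum_j A j y * cpartial F j y) i x =
  \sum_j (\sum_i (A i x * cpartial (B j) i x - B i x * cpartial (A j) i x)) *
         cpartial F j x.
Proof.
move=> oD Dx CA CB CF.
have E (A' B' : 'I_m -> 'rV[R]_m -> C) : (forall i, cCinfty D (B' i)) ->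
    \sum_i A' i x * cpartial (fun y => \sum_j B' j y * cpartial F j y) i x =
    \sum_j \sum_i A' i x * cpartial (B' j) i x * cpartial F j x +
    \sum_i \sum_j A' i x * B' j x * cpartial (cpartial F j) i x.
  move=> CB'; rewrite exchange_big -big_split; apply: eq_bigr => i _ /=.
  rewrite (cpartial_sum _ _ oD Dx); last first.
    by move=> j; apply: cCinftyM (CB' j) (cCinfty_partial j CF).
  rewrite mulr_sumr -big_split; apply: eq_bigr => j _ /=.
  rewrite (cpartialM _ Dx (CB' j) (cCinfty_partial j CF)).
  by rewrite mulrDr !mulrA addrC.
rewrite !E // [X in _ - (_ + X)]exchange_big /=.
rewrite [X in _ - (_ + X)](eq_bigr (fun j =>
    \sum_i A j x * B i x * cpartial (cpartial F i) j x)); last first.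
  move=> j _; apply: eq_bigr => i _.
  by rewrite (cpartialC i j oD Dx CF) [B i x * _]mulrC.
rewrite [X in _ - X]addrC addrKA -sumrB; apply: eq_bigr => j _.
by rewrite -sumrB mulr_suml; apply: eq_bigr => i _; rewrite mulrBl.
Qed.

End ComplexSmooth.

(** * Smooth functions and vector fields *)

Section ManifoldCalculus.
Context {R : realType} {m : nat} {M : smooth_manifold R m}.
Local Notation C := R[i].
Implicit Types (c : chart R m M) (U V : set M) (f g : M -> C) (p q : M).

Definition chart_img c U := cmap c @` (U `&` cdom c).

Lemma chart_img_open c U : open U -> open (chart_img c U).
Proof.
move=> oU; rewrite openE => _ [q [Uq cq] <-].
have img_q : (cmap c @` cdom c) (cmap c q) by exists q.
have E : cinv c (cmap c q) = q by apply: chart_cancel; rewrite inE.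
have near_U : nbhs (cmap c q) (cinv c @^-1` U).
  have cont : {for cmap c q, continuous (cinv c)}.
    by apply: (@chart_inv_continuous _ _ _ c); rewrite inE.
  by apply: cont; rewrite /= E; exact: open_nbhs_nbhs.
have near_img := open_nbhs_nbhs (conj (@chart_open_img _ _ _ c) img_q).
apply: filterS (filterI near_img near_U) => _ [[q' cq' <-]].
rewrite /preimage /= chart_cancel ?inE // => Uq'.
by exists q'.
Qed.

Lemma chart_imgP c U x : chart_img c U x -> [/\ U (cinv c x), cdom c (cinv c x) &
  cmap c (cinv c x) = x].
Proof. by move=> [q [Uq cq] <-]; rewrite chart_cancel ?inE. Qed.

Lemma mem_chart_img c U p : U p -> cdom c p -> chart_img c U (cmap c p).
Proof. by exists p. Qed.

Lemma chart_img_sub c U V : U `<=` V -> chart_img c U `<=` chart_img c V.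
Proof. by move=> UV _ [q [/UV Vq cq] <-]; exists q. Qed.

Lemma smoothE U f : smooth U f <->
  forall c, atlas M c -> cCinfty (chart_img c U) (f \o cinv c).
Proof. by []. Qed.

Lemma smooth_chart c U f : atlas M c -> smooth U f ->
  cCinfty (chart_img c U) (f \o cinv c).
Proof. by move=> ac sf; exact: sf. Qed.

Lemma smooth_ext U f g : open U -> (forall q, U q -> f q = g q) ->
  smooth U f -> smooth U g.
Proof.
move=> oU fg sf; apply/smoothE => c ac.
apply: cCinfty_ext (chart_img_open (c := c) oU) _ (smooth_chart ac sf).
by move=> x /chart_imgP [Ux _ _] /=; exact: fg.
Qed.

Lemma smooth_sub U V f : V `<=` U -> smooth U f -> smooth V f.
Proof.
move=> VU sf; apply/smoothE => c ac.
by apply: cCinfty_sub (smooth_chart ac sf); exact: chart_img_sub.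
Qed.

Lemma smooth_local U f : (forall p, U p -> exists2 V, V p & smooth V f) -> smooth U f.
Proof.
move=> loc; apply/smoothE => c ac; apply: cCinfty_local => x Ux; have [Uq cq Ex] := chart_imgP Ux.
have [V Vq sV] := loc _ Uq; exists (chart_img c V); last exact: smooth_chart sV.
by rewrite -Ex; exact: mem_chart_img.
Qed.

Lemma smooth_cst U (a : C) : smooth U (fun=> a).
Proof. by apply/smoothE => c _; exact: cCinfty_cst. Qed.

Lemma smoothD U f g : open U -> smooth U f -> smooth U g -> smooth U (fun q => f q + g q).
Proof.
move=> oU sf sg; apply/smoothE => c ac.
exact: cCinftyD (chart_img_open (c := c) oU) (smooth_chart ac sf) (smooth_chart ac sg).
Qed.

Lemma smoothM U f g : open U -> smooth U f -> smooth U g -> smooth U (fun q => f q * g q).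
Proof.
move=> oU sf sg; apply/smoothE => c ac.
exact: cCinftyM (chart_img_open (c := c) oU) (smooth_chart ac sf) (smooth_chart ac sg).
Qed.

Lemma smooth_conj U f : open U -> smooth U f -> smooth U (fun q => (f q)^*).
Proof.
move=> oU sf; apply/smoothE => c ac.
exact: cCinfty_conj (chart_img_open (c := c) oU) (smooth_chart ac sf).
Qed.

Lemma smoothV U f : open U -> (forall q, U q -> f q != 0) -> smooth U f ->
  smooth U (fun q => (f q)^-1).
Proof.
move=> oU f0 sf; apply/smoothE => c ac.
apply: cCinftyV (chart_img_open (c := c) oU) _ (smooth_chart ac sf).
by move=> x /chart_imgP [Ux _ _]; exact: f0.
Qed.

Lemma smoothN U f : open U -> smooth U f -> smooth U (fun q => - f q).
Proof.
move=> oU sf; apply: smooth_ext (smoothM oU (smooth_cst U (-1)) sf) => // q _.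
by rewrite mulN1r.
Qed.

Lemma smooth_sum (I : Type) (r : seq I) (P : pred I) U (f : I -> M -> C) : open U ->
  (forall i, P i -> smooth U (f i)) -> smooth U (fun q => \sum_(i <- r | P i) f i q).
Proof.
move=> oU sf; elim: r => [|i r IH].
  by apply: smooth_ext (smooth_cst U 0) => // q _; rewrite big_nil.
case Pi: (P i); last by apply: smooth_ext IH => // q _; rewrite big_cons Pi.
by apply: smooth_ext (smoothD oU (sf i Pi) IH) => // q _; rewrite big_cons Pi.
Qed.

Lemma smooth_prod (I : Type) (r : seq I) (P : pred I) U (f : I -> M -> C) : open U ->
  (forall i, P i -> smooth U (f i)) -> smooth U (fun q => \prod_(i <- r | P i) f i q).
Proof.
move=> oU sf; elim: r => [|i r IH].
  by apply: smooth_ext (smooth_cst U 1) => // q _; rewrite big_nil.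
case Pi: (P i); last by apply: smooth_ext IH => // q _; rewrite big_cons Pi.
by apply: smooth_ext (smoothM oU (sf i Pi) IH) => // q _; rewrite big_cons Pi.
Qed.

Definition coordinate c (i : 'I_m) : M -> C := fun q => (cmap c q ord0 i)%:C.

(** Read in another chart, a coordinate is a component of a transition map, so this is the
    compatibility of the atlas. *)
Lemma smooth_coordinate c i : atlas M c -> smooth (cdom c) (coordinate c i).
Proof.
move=> ac d ad; split; last by move=> k; exact: (Ck_cst k _ 0).
have [_ /(_ d c ad ac i)] := manifold_atlas M.
by rewrite setIC.
Qed.

Lemma coord_partial_eq c i f g p U : open U -> U p -> cdom c p ->
  (forall q, U q -> f q = g q) -> coord_partial c i f p = coord_partial c i g p.
Proof.
move=> oU Up cp fg; apply: (cpartial_near_eq (F := f \o cinv c) (G := g \o cinv c)).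
apply: open_near_eq (chart_img_open (c := c) oU) (mem_chart_img Up cp) _.
by move=> x /chart_imgP [Ux _ _]; exact: fg.
Qed.

Lemma coord_partial_coordinate c i j p : cdom c p ->
  coord_partial c j (coordinate c i) p = (i == j)%:R.
Proof.
move=> cp; pose F (x : 'rV[R]_m) : C := (x ord0 i)%:C.
have -> : coord_partial c j (coordinate c i) p = cpartial F j (cmap c p).
  apply: cpartial_near_eq.
  apply: open_near_eq (chart_img_open (c := c) openT) (mem_chart_img I cp) _.
  by move=> x /chart_imgP [_ _ Ex]; rewrite /coordinate Ex.
rewrite /cpartial /= (partial_coord i j (cmap c p)).2 /partial derive_cst.
by case: (i == j).
Qed.

Lemma smooth_near_ext f g p U : open U -> U p -> (forall q, U q -> f q = g q) ->
  smooth_near p f -> smooth_near p g.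
Proof.
move=> oU Up fg [V [oV Vp sf]]; exists (U `&` V); split=> //; first exact: openI.
apply: smooth_ext (openI oU oV) _ (smooth_sub (@subIsetr _ _ _) sf) => q [Uq _].
exact: fg.
Qed.

Lemma smooth_nearP f g p : smooth_near p f -> smooth_near p g ->
  exists U, [/\ open U, U p, smooth U f & smooth U g].
Proof.
move=> [U [oU Up sf]] [V [oV Vp sg]]; exists (U `&` V).
split=> //; [exact: openI|exact: smooth_sub (@subIsetl _ _ _) sf|].
exact: smooth_sub (@subIsetr _ _ _) sg.
Qed.

Lemma smooth_near_conj f p : smooth_near p (fun q => (f q)^*) <-> smooth_near p f.
Proof.
split=> [[U [oU Up sf]]|[U [oU Up sf]]]; exists U; split=> //; last exact: smooth_conj.
by apply: smooth_ext (smooth_conj oU sf) => // q _; rewrite conjcK.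
Qed.

Lemma coord_partialD c i f g p U : atlas M c -> open U -> U p -> cdom c p ->
  smooth U f -> smooth U g ->
  coord_partial c i (fun q => f q + g q) p = coord_partial c i f p + coord_partial c i g p.
Proof.
move=> ac oU Up cp sf sg.
exact: cpartialD (mem_chart_img Up cp) (smooth_chart ac sf) (smooth_chart ac sg).
Qed.

Lemma coord_partial_conj c i f p U : atlas M c -> U p -> cdom c p ->
  smooth U f -> coord_partial c i (fun q => (f q)^*) p = (coord_partial c i f p)^*.
Proof. by move=> ac Up cp sf; exact: cpartial_conj (mem_chart_img Up cp) (smooth_chart ac sf). Qed.

End ManifoldCalculus.

(** * Tangent vectors, vector fields and their Lie bracket *)

Section TangentVectors.
Context {R : realType} {m : nat} {M : smooth_manifold R m}.
Local Notation C := R[i].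
Implicit Types (c : chart R m M) (U V : set M) (f g : M -> C) (p q : M).
Implicit Types (v w : functional M) (X Y Z : field M).

Lemma chart_at p : exists2 c, atlas M c & cdom c p.
Proof. by have [+ _] := manifold_atlas M; apply. Qed.

Lemma coordinate_near c i p : atlas M c -> cdom c p -> smooth_near p (coordinate c i).
Proof.
by move=> ac cp; exists (cdom c); split=> //; [exact: chart_open_dom|exact: smooth_coordinate].
Qed.

Lemma functionalDE v w f : (v + w) f = (v f : C) + (w f : C).
Proof. by []. Qed.

Lemma functionalZE (a : C) v f : (a *: v) f = a * (v f : C).
Proof. by []. Qed.

Lemma fieldDE X Y p f : (X + Y) p f = (X p f : C) + (Y p f : C).
Proof. by []. Qed.

Lemma fieldNE X p f : (- X) p f = - (X p f : C).
Proof. by []. Qed.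

Lemma tangent_rough p v f : tangent p v -> ~ smooth_near p f -> v f = 0.
Proof.
have [c ac cp] := chart_at p => /(_ c ac cp) [a ->] nsf.
by rewrite asboolF.
Qed.

(** Evaluating [v] on the coordinate functions recovers the coefficients promised by [tangent]. *)
Lemma tangentE c p v f : tangent p v -> atlas M c -> cdom c p -> smooth_near p f ->
  v f = \sum_(i < m) v (coordinate c i) * coord_partial c i f p.
Proof.
move=> /(_ c) tv ac cp sf; have [a va] := tv ac cp.
rewrite va asboolT //; apply: eq_bigr => i _; congr (_ * _).
rewrite va asboolT; last exact: coordinate_near.
rewrite (bigD1 i) //= coord_partial_coordinate // eqxx mulr1 big1 ?addr0 // => j ji.
by rewrite coord_partial_coordinate // eq_sym (negPf ji) mulr0.
Qed.

Lemma tangent_ext p v f g U : tangent p v -> open U -> U p ->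
  (forall q, U q -> f q = g q) -> v f = v g.
Proof.
move=> tv oU Up fg; have [c ac cp] := chart_at p.
have [sf|nsf] := pselect (smooth_near p f); last first.
  rewrite !(tangent_rough tv) // => sg; apply: nsf.
  by apply: smooth_near_ext oU Up _ sg => q Uq; rewrite fg.
rewrite !(tangentE tv ac cp) //; last exact: smooth_near_ext oU Up fg sf.
by apply: eq_bigr => i _; rewrite (coord_partial_eq i oU Up cp fg).
Qed.

(** Both functions must be smooth: [v] sends two rough functions to 0 but may be nonzero on their
    sum, if that is smooth. *)
Lemma tangentD_fun p v f g : tangent p v -> smooth_near p f -> smooth_near p g ->
  v (fun q => f q + g q) = v f + v g.
Proof.
move=> tv sf sg; have [c ac cp] := chart_at p.
have [U [oU Up sUf sUg]] := smooth_nearP sf sg.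
have sfg : smooth_near p (fun q => f q + g q) by exists U; split=> //; exact: smoothD.
rewrite !(tangentE tv ac cp) // -big_split; apply: eq_bigr => i _ /=.
by rewrite -mulrDr (coord_partialD i ac oU Up cp sUf sUg).
Qed.

Lemma tangentN_fun p v f : tangent p v -> smooth_near p f -> v (fun q => - f q) = - v f.
Proof.
move=> tv sf; have sNf : smooth_near p (fun q => - f q).
  by case: sf => U [oU Up sf]; exists U; split=> //; exact: smoothN.
have s0 : smooth_near p (fun=> 0 : C) by exists setT; split; [exact: openT| |exact: smooth_cst].
have v0 : v (fun=> 0) = 0.
  by apply: (addIr (v (fun=> 0))); rewrite -(tangentD_fun tv s0 s0) !add0r.
apply: (addIr (v f)); rewrite addNr -(tangentD_fun tv sNf sf) -[RHS]v0.
by congr (v _); apply/funext => q; rewrite addNr.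
Qed.

Lemma tangentB_fun p v f g : tangent p v -> smooth_near p f -> smooth_near p g ->
  v (fun q => f q - g q) = v f - v g.
Proof.
move=> tv sf sg; have sNg : smooth_near p (fun q => - g q).
  by case: sg => U [oU Up sg]; exists U; split=> //; exact: smoothN.
by rewrite (tangentD_fun tv sf sNg) (tangentN_fun tv sg).
Qed.

Lemma tangent_eq c p v w : atlas M c -> cdom c p -> tangent p v -> tangent p w ->
  (forall i, v (coordinate c i) = w (coordinate c i)) -> v = w.
Proof.
move=> ac cp tv tw vw; apply/funext => f.
have [sf|nsf] := pselect (smooth_near p f); last by rewrite !(@tangent_rough p).
by rewrite (tangentE tv ac cp sf) (tangentE tw ac cp sf); apply: eq_bigr => i _; rewrite vw.
Qed.

Lemma tangent0 p : tangent p (0 : functional M).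
Proof.
move=> c ac cp; exists (fun=> 0) => f; case: asboolP => _ //.
by rewrite big1 // => i _; rewrite mul0r.
Qed.

Lemma tangentD p v w : tangent p v -> tangent p w -> tangent p (v + w).
Proof.
move=> tv tw c ac cp; have [a va] := tv c ac cp; have [b wb] := tw c ac cp.
exists (fun i => a i + b i) => f; rewrite functionalDE va wb.
case: asboolP => _; last by rewrite addr0.
by rewrite -big_split; apply: eq_bigr => i _; rewrite mulrDl.
Qed.

Lemma tangentZ p (a : C) v : tangent p v -> tangent p (a *: v).
Proof.
move=> tv c ac cp; have [b vb] := tv c ac cp.
exists (fun i => a * b i) => f; rewrite functionalZE vb.
case: asboolP => _; last by rewrite mulr0.
by rewrite mulr_sumr; apply: eq_bigr => i _; rewrite mulrA.
Qed.

Lemma tangent_sum p (I : Type) (r : seq I) (v : I -> functional M) :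
  (forall i, tangent p (v i)) -> tangent p (\sum_(i <- r) v i).
Proof. by move=> tv; apply: big_ind => //; [exact: tangent0|exact: tangentD]. Qed.

Lemma tangent_conj p v : tangent p v -> tangent p (conjv v).
Proof.
move=> tv c ac cp; have [a va] := tv c ac cp.
exists (fun i => (a i)^*) => f; rewrite /conjv va.
case: asboolP => [sf|nsf]; case: asboolP => [sf'|nsf'].
- have [U [oU Up sU]] := sf'; rewrite raddf_sum; apply: eq_bigr => i _.
  rewrite /= (coord_partial_conj i ac Up cp sU) rmorphM.
  by rewrite -[in RHS](conjcK (coord_partial c i f p)).
- by case: nsf'; apply/smooth_near_conj.
- by case: nsf; apply/smooth_near_conj.
- by rewrite rmorph0.
Qed.

Lemma conjvK : involutive (@conjv R m M).
Proof.
move=> v; apply/funext => f; rewrite /conjv conjcK; congr (v _).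
by apply/funext => q; rewrite conjcK.
Qed.

Lemma conjvD v w : conjv (v + w) = conjv v + conjv w.
Proof. by apply/funext => f; exact: rmorphD. Qed.

Lemma conjvZ (a : C) v : conjv (a *: v) = a^* *: conjv v.
Proof. by apply/funext => f; exact: rmorphM. Qed.

Lemma conjv0 : conjv (0 : functional M) = 0.
Proof. by apply/funext => f; exact: rmorph0. Qed.

Lemma conjv_sum (I : Type) (r : seq I) (v : I -> functional M) :
  conjv (\sum_(i <- r) v i) = \sum_(i <- r) conjv (v i).
Proof. exact: (big_morph _ conjvD conjv0). Qed.

Lemma vfield_tangent U X p : vfield U X -> U p -> tangent p (X p).
Proof. by move=> [tX _]; exact: tX. Qed.

Lemma vfield_smooth U V X f : vfield U X -> open V -> V `<=` U -> smooth V f ->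
  smooth V (apply_field X f).
Proof. by move=> [_ sX]; exact: sX. Qed.

Lemma vfield_sub U V X : V `<=` U -> vfield U X -> vfield V X.
Proof.
move=> VU [tX sX]; split=> [p /VU|W f oW WV]; first exact: tX.
by apply: sX => //; exact: subset_trans VU.
Qed.

Lemma vfield_ext U X Y : open U -> (forall p, U p -> X p = Y p) -> vfield U X -> vfield U Y.
Proof.
move=> oU XY [tX sX]; split=> [p Up|V f oV VU sf]; first by rewrite -XY //; exact: tX.
by apply: smooth_ext (sX V f oV VU sf) => // q /VU Uq; rewrite /apply_field XY.
Qed.

Lemma vfield_local U X : (forall p, U p -> exists V, [/\ open V, V p & vfield V X]) ->
  vfield U X.
Proof.
move=> loc; split=> [p /loc [V [_ Vp [tX _]]]|W f oW WU sf]; first exact: tX.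
apply: smooth_local => p Wp; have [V [oV Vp [_ sX]]] := loc p (WU p Wp).
exists (W `&` V) => //; apply: sX; [exact: openI|exact: subIsetr|].
exact: smooth_sub (@subIsetl _ _ _) sf.
Qed.

Lemma vfield0 U : vfield U (0 : field M).
Proof. by split=> [p _|V f _ _ _]; [exact: tangent0|exact: smooth_cst]. Qed.

Lemma vfieldD U X Y : vfield U X -> vfield U Y -> vfield U (X + Y).
Proof.
move=> [tX sX] [tY sY]; split=> [p Up|V f oV VU sf].
  by apply: tangentD; [exact: tX|exact: tY].
exact: smoothD oV (sX V f oV VU sf) (sY V f oV VU sf).
Qed.

Lemma vfieldM U (a : M -> C) X : smooth U a -> vfield U X ->
  vfield U (fun p => a p *: X p).
Proof.
move=> sa [tX sX]; split=> [p Up|V f oV VU sf]; first exact/tangentZ/tX.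
exact: smoothM oV (smooth_sub VU sa) (sX V f oV VU sf).
Qed.

Lemma vfieldZ U (a : C) X : vfield U X -> vfield U (a *: X).
Proof. exact/vfieldM/smooth_cst. Qed.

Lemma vfield_sum U (I : Type) (r : seq I) (X : I -> field M) :
  (forall i, vfield U (X i)) -> vfield U (\sum_(i <- r) X i).
Proof. by move=> vX; apply: big_ind => //; [exact: vfield0|exact: vfieldD]. Qed.

Lemma vfield_conj U X : vfield U X -> vfield U (conjf X).
Proof.
move=> [tX sX]; split=> [p Up|V f oV VU sf]; first exact/tangent_conj/tX.
exact: smooth_conj oV (sX V _ oV VU (smooth_conj oV sf)).
Qed.

Lemma vfield_near U X f p : open U -> U p -> vfield U X -> smooth_near p f ->
  smooth_near p (apply_field X f).
Proof.
move=> oU Up vX [V [oV Vp sf]]; have oW := openI oU oV.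
exists (U `&` V); split=> //; apply: (vfield_smooth vX oW); first exact: subIsetl.
exact: smooth_sub (@subIsetr _ _ _) sf.
Qed.

Lemma lieE X Y f p : smooth_near p f ->
  lie X Y p f = X p (apply_field Y f) - Y p (apply_field X f).
Proof. by move=> sf; rewrite /lie asboolT. Qed.

Lemma lie_rough X Y f p : ~ smooth_near p f -> lie X Y p f = 0.
Proof. by move=> nsf; rewrite /lie asboolF. Qed.

Lemma lieC X Y : lie X Y = - lie Y X.
Proof.
apply/funext => p; apply/funext => f; rewrite fieldNE /lie.
by case: asboolP => _; rewrite ?opprB ?oppr0.
Qed.

Lemma conjf_lie X Y : conjf (lie X Y) = lie (conjf X) (conjf Y).
Proof.
apply/funext => p; apply/funext => f.
rewrite {1}/conjf /conjv.
have E (Z W : field M) : conjf Z p (apply_field (conjf W) f) =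
    (Z p (apply_field W (fun q => (f q)^*)))^*.
  rewrite /conjf /conjv; congr ((Z p _)^*); apply/funext => q.
  by rewrite /apply_field conjcK.
have [sf|nsf] := pselect (smooth_near p f).
  by rewrite !lieE ?E ?rmorphB //; apply/smooth_near_conj.
by rewrite !lie_rough ?rmorph0 // => /smooth_near_conj.
Qed.

Lemma vfield_lie U X Y : open U -> vfield U X -> vfield U Y -> vfield U (lie X Y).
Proof.
move=> oU vX vY; split=> [p Up|V f oV VU sf]; last first.
  apply: (smooth_ext (f := fun q => X q (apply_field Y f) - Y q (apply_field X f))) => //.
    by move=> q Vq; rewrite -lieE //; exists V.
  apply: smoothD => //; last apply: smoothN => //.
    exact: (vfield_smooth vX oV VU (vfield_smooth vY oV VU sf)).
  exact: (vfield_smooth vY oV VU (vfield_smooth vX oV VU sf)).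
move=> c ac cp; pose x0 := cmap c p.
pose A (Z : field M) i := apply_field Z (coordinate c i) \o cinv c.
(* The components of the bracket in coordinates, as found in [commutator_partial]. *)
exists (fun j => \sum_i (A X i x0 * cpartial (A Y j) i x0 - A Y i x0 * cpartial (A X j) i x0)).
move=> f; case: asboolP => [sf|nsf]; last exact: lie_rough.
have [V [oV Vp sVf]] := sf; pose W := U `&` V `&` cdom c.
have oc := @chart_open_dom _ _ _ c.
have oW : open W by apply: openI => //; exact: openI.
have Wp : W p by [].
have WU : W `<=` U by move=> q [[]].
have sWf : smooth W f by apply: smooth_sub sVf => q [[]].
have sWc i : smooth W (coordinate c i).
  by apply: smooth_sub (smooth_coordinate i ac) => q [].
pose D := chart_img c W; have oD : open D by exact: chart_img_open.
have Dx0 : D x0 by exact: mem_chart_img.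
have CA Z : vfield U Z -> forall i, cCinfty D (A Z i).
  by move=> vZ i; apply: (smooth_chart ac); exact: (vfield_smooth vZ oW WU).
pose F := f \o cinv c.
have CF : cCinfty D F by exact: smooth_chart ac sWf.
have E (Z Z' : field M) : vfield U Z -> vfield U Z' -> Z p (apply_field Z' f) =
    \sum_i A Z i x0 * cpartial (fun y => \sum_j A Z' j y * cpartial F j y) i x0.
  move=> vZ vZ'; rewrite (tangentE (vfield_tangent vZ Up) ac cp); last first.
    exact: vfield_near oU Up vZ' sf.
  apply: eq_bigr => i _; congr (_ * _).
    by rewrite /A /= /apply_field /x0 chart_cancel ?inE.
  apply: cpartial_near_eq; apply: open_near_eq oD Dx0 _ => y /chart_imgP [Wy cy Ey].
  rewrite [LHS](_ : _ = Z' (cinv c y) f) //.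
  rewrite (tangentE (vfield_tangent vZ' (WU _ Wy)) ac cy); last by exists W.
  by apply: eq_bigr => j _; rewrite /A /= /apply_field; congr (_ * _); rewrite -{2}Ey.
rewrite lieE // !E // (commutator_partial oD Dx0 (CA X vX) (CA Y vY) CF).
by [].
Qed.

Lemma lieDl X X' Y : vfield setT X -> vfield setT X' -> vfield setT Y ->
  lie (X + X') Y = lie X Y + lie X' Y.
Proof.
move=> vX vX' vY; apply/funext => p; apply/funext => f.
rewrite [RHS]fieldDE.
have [sf|nsf] := pselect (smooth_near p f); last by rewrite !lie_rough ?addr0.
rewrite !lieE // fieldDE.
have -> : Y p (apply_field (X + X') f) = Y p (apply_field X f) + Y p (apply_field X' f).
  by apply: tangentD_fun (vfield_tangent vY I) _ _; apply: (vfield_near openT I).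
by rewrite opprD addrACA.
Qed.

Lemma lie_jacobi X Y Z : vfield setT X -> vfield setT Y -> vfield setT Z ->
  lie (lie X Y) Z + lie (lie Y Z) X + lie (lie Z X) Y = 0.
Proof.
move=> vX vY vZ; apply/funext => p; apply/funext => f.
rewrite [LHS]fieldDE fieldDE.
have [sf|nsf] := pselect (smooth_near p f); last by rewrite !lie_rough ?addr0.
have near_app A : vfield setT A -> forall g, smooth_near p g -> smooth_near p (apply_field A g).
  by move=> vA g; apply: (vfield_near openT I vA).
(* [lie A B] is the commutator only on functions smooth near the point, so [D] is applied to it
   after restriction to a neighbourhood where [f] is smooth. The twelve resulting triple
   compositions then cancel. *)
have E A B D : vfield setT A -> vfield setT B -> vfield setT D ->
    lie (lie A B) D p f = A p (apply_field B (apply_field D f)) -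
      B p (apply_field A (apply_field D f)) -
      (D p (apply_field A (apply_field B f)) - D p (apply_field B (apply_field A f))).
  move=> vA vB vD; rewrite lieE // lieE; last exact: near_app.
  rewrite -(tangentB_fun (vfield_tangent vD I));
    [|exact: near_app (near_app _ vB _ sf)|exact: near_app (near_app _ vA _ sf)].
  have [V [oV Vp sV]] := sf; congr (_ - _).
  apply: (tangent_ext (vfield_tangent vD I) oV Vp) => q Vq.
  by rewrite {1}/apply_field lieE //; exists V.
rewrite !E //; set a := X p _; set b := Y p _; ring.
Qed.

End TangentVectors.

(** * Splitting of vector fields *)

Section Frames.
Context {R : realType}.
Local Notation C := R[i].

Lemma functional_sumE (m : nat) (M : smooth_manifold R m) (I : Type) (r : seq I)
    (v : I -> functional M) (f : M -> C) :
  (\sum_(i <- r) v i) f = \sum_(i <- r) (v i f : C).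
Proof. exact: (big_morph (fun v : functional M => v f : C)). Qed.

Lemma smooth_det (m : nat) (M : smooth_manifold R m) (U : set M) k (A : M -> 'M[C]_k) :
  open U -> (forall i j, smooth U (fun q => A q i j)) ->
  smooth U (fun q => \det (A q)).
Proof.
move=> oU sA; apply: smooth_sum => // s _; apply: smoothM => //; first exact: smooth_cst.
by apply: smooth_prod.
Qed.

Lemma smooth_adj (m : nat) (M : smooth_manifold R m) (U : set M) k (A : M -> 'M[C]_k) i j :
  open U -> (forall i j, smooth U (fun q => A q i j)) ->
  smooth U (fun q => (\adj (A q)) i j).
Proof.
move=> oU sA.
apply: (smooth_ext (f := fun q => (-1) ^+ (j + i) * \det (row' j (col' i (A q))))) => //.
  by move=> q _; rewrite mxE.
apply: smoothM => //; first exact: smooth_cst.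
apply: smooth_det => // a b.
apply: (smooth_ext (f := fun q => A q (lift j a) (lift i b))) => // q _.
by rewrite !mxE.
Qed.

Lemma frame_coefficients (m : nat) (M : smooth_manifold R m) (c : chart R m M) (k : nat)
    (U : set M) (b : 'I_k -> field M) :
  m = k -> open U -> U `<=` cdom c -> atlas M c -> (forall i, vfield U (b i)) ->
  (forall q, U q -> forall a : 'I_k -> C,
     \sum_(i < k) a i *: b i q = 0 -> forall i, a i = 0) ->
  forall X, vfield U X -> exists a : 'I_k -> M -> C,
    (forall i, smooth U (a i)) /\
    (forall q, U q -> X q = \sum_(i < k) a i q *: b i q).
Proof.
move=> mk; subst k => oU Uc ac vb free X vX.
pose B q : 'M[C]_m := \matrix_(j, i) (b j q (coordinate c i) : C).
have sc i : smooth U (coordinate c i) by exact: smooth_sub Uc (smooth_coordinate i ac).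
have tb q i : U q -> tangent q (b i q) by move=> Uq; exact: vfield_tangent (vb i) Uq.
(* A row killed by [B q] gives a combination of the frame whose values on all coordinates vanish; it
   is zero as a tangent vector, so freeness applies. *)
have unitB q : U q -> B q \in unitmx.
  move=> Uq; rewrite -row_free_unit -kermx_eq0; apply/rowV0P => v /sub_kermxP vB0.
  apply/rowP => i; rewrite mxE; apply: (free q Uq (fun i => v ord0 i)).
  apply: (tangent_eq ac (Uc q Uq)); last first.
  - move=> j; rewrite functional_sumE; have := congr1 (fun w : 'rV_m => w ord0 j) vB0.
    by rewrite !mxE; apply: etrans; apply: eq_bigr => l _; rewrite mxE.
  - exact: tangent0.
  - by apply: tangent_sum => j; apply: tangentZ; exact: tb.
(* The row of coordinates of [X] times the inverse of [B]. *)
pose a i q := \sum_j (X q (coordinate c j) : C) * invmx (B q) j i.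
exists a; split=> [i|q Uq].
  apply: smooth_sum => // j _; apply: smoothM => //.
    exact: (vfield_smooth vX oU).
  have sB i' j' : smooth U (fun q => B q i' j').
    apply: (smooth_ext (f := fun q => (b i' q (coordinate c j') : C))) => //.
      by move=> q _; rewrite mxE.
    exact: (vfield_smooth (vb i') oU).
  apply: (smooth_ext (f := fun q => (\det (B q))^-1 * (\adj (B q)) j i)) => //.
    by move=> q Uq; rewrite /invmx unitB // [RHS]mxE.
  apply: smoothM => //; last exact: smooth_adj.
  by apply: smoothV => //; exact: smooth_det.
apply: (tangent_eq ac (Uc q Uq)).
- exact: vfield_tangent vX Uq.
- by apply: tangent_sum => j; apply: tangentZ; exact: tb.
move=> i; rewrite functional_sumE.
pose x : 'rV[C]_m := \row_j (X q (coordinate c j) : C).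
have := congr1 (fun w : 'rV_m => w ord0 i) (mulmxKV (unitB q Uq) x).
rewrite !mxE => <-; apply: eq_bigr => l _; rewrite !mxE /a.
by congr (_ * _); apply: eq_bigr => j _; rewrite mxE.
Qed.

End Frames.

Section Splitting.
Context {R : realType} {m : nat} {M : smooth_manifold R m}.
Local Notation C := R[i].
Context (E : M -> set (functional M)) (zeta : field M) (n : nat).
Context (n_gt0 : (0 < n)%N) (spcE : is_normal_spc E zeta n).
Implicit Types (X Y : field M) (p q : M) (v w : functional M).

Let crE : is_cr E n := spc_cr spcE.

Lemma E_basis p : exists b : 'I_n.-1 -> functional M, is_basis (E p) b.
Proof. by have [U [b [_ Up _ /(_ p Up) ?]]] := cr_subbundle crE p; exists (b^~ p). Qed.

Lemma E_D p v w : E p v -> E p w -> E p (v + w).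
Proof.
have [b [Eb _]] := E_basis p; move=> /Eb [a ->] /Eb [a' ->]; apply/Eb.
by exists (fun i => a i + a' i); rewrite -big_split; apply: eq_bigr => i _; rewrite scalerDl.
Qed.

Lemma E_Z p (a : C) v : E p v -> E p (a *: v).
Proof.
have [b [Eb _]] := E_basis p; move=> /Eb [a' ->]; apply/Eb.
by exists (fun i => a * a' i); rewrite scaler_sumr; apply: eq_bigr => i _; rewrite scalerA.
Qed.

Lemma E_0 p : E p 0.
Proof.
have [b [Eb _]] := E_basis p; apply/Eb; exists (fun=> 0).
by rewrite big1 // => i _; rewrite scale0r.
Qed.

Lemma Ebar_D p v w : Ebar E p v -> Ebar E p w -> Ebar E p (v + w).
Proof. by rewrite /Ebar /= conjvD; exact: E_D. Qed.

Lemma Ebar_Z p (a : C) v : Ebar E p v -> Ebar E p (a *: v).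
Proof. by rewrite /Ebar /= conjvZ; exact: E_Z. Qed.

Lemma Ebar_0 p : Ebar E p 0.
Proof. by rewrite /Ebar /= conjv0; exact: E_0. Qed.

Lemma E_N p v : E p v -> E p (- v).
Proof. by rewrite -scaleN1r; exact: E_Z. Qed.

Lemma Ebar_N p v : Ebar E p v -> Ebar E p (- v).
Proof. by rewrite -scaleN1r; exact: Ebar_Z. Qed.

(** If [a] were nonzero, dividing by [- a] would put [zeta p] into the sum of [E] and [Ebar]; if it
    is zero, [v = - w] lies in both. *)
Lemma split0 p v w (a : C) : E p v -> Ebar E p w -> v + w + a *: zeta p = 0 ->
  [/\ v = 0, w = 0 & a = 0].
Proof.
move=> Ev Ew; have [-> | a0] := eqVneq a 0.
  rewrite scale0r addr0 => /eqP; rewrite addr_eq0 => /eqP vw.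
  have v0 : v = 0 by apply: (cr_transverse crE Ev); rewrite vw; exact: Ebar_N.
  by move: vw; rewrite v0 => /eqP; rewrite eq_sym oppr_eq0 => /eqP ->.
move=> /eqP; rewrite addrC addr_eq0 => /eqP az.
case: (spc_transverse spcE (p := p) (v := - a^-1 *: v) (w := - a^-1 *: w)).
- exact: E_Z.
- exact: Ebar_Z.
- by rewrite -scalerDr scaleNr -scalerN -az scalerA mulVf // scale1r.
Qed.

Lemma split_inj p v w v' w' (a a' : C) :
  E p v -> Ebar E p w -> E p v' -> Ebar E p w' ->
  v + w + a *: zeta p = v' + w' + a' *: zeta p -> [/\ v = v', w = w' & a = a'].
Proof.
move=> Ev Ew Ev' Ew' eq.
have [|||v0 w0 a0] := @split0 p (v - v') (w - w') (a - a').
- by apply: E_D => //; exact: E_N.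
- by apply: Ebar_D => //; exact: Ebar_N.
- by rewrite scalerBl (addrACA v) (addrACA (v + w)) -!opprD eq subrr.
- by split; apply/eqP; rewrite -subr_eq0; apply/eqP.
Qed.

(** [xget] picks some decomposition; uniqueness forces it to be the given one. *)
Lemma cr_splitP p v w (a : C) : E p v -> Ebar E p w ->
  cr_split E zeta p (v + w + a *: zeta p) = (v, w, a *: zeta p).
Proof.
move=> Ev Ew; rewrite /cr_split; case: xgetP => [[[v' w'] z'] _|/(_ (v, w, a *: zeta p)) []].
  move=> /= [Ev' Ew' [a' ->] eq].
  by have [-> -> ->] := split_inj Ev Ew Ev' Ew' eq.
by split=> //=; exists a.
Qed.

Lemma local_frame p : exists (U : set M) (c : chart R m M) (e : 'I_n.-1 -> field M),
  [/\ open U, U p, U `<=` cdom c, atlas M c &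
   (forall i, vfield U (e i)) /\ (forall q, U q -> is_basis (E q) (e^~ q))].
Proof.
have [U [e [oU Up ve be]]] := cr_subbundle crE p.
have [c ac cp] := chart_at p; exists (U `&` cdom c), c, e; split=> //.
- by apply: openI => //; exact: chart_open_dom.
- split=> [i|q [Uq _]]; last exact: be.
  by apply: vfield_sub (ve i) => q [].
Qed.

Lemma local_splitting V X p : open V -> V p -> vfield V X ->
  exists (U : set M) (Y Z : field M) (a : M -> C),
    [/\ open U, U p, U `<=` V, vfield U Y &
     forall q, U q -> [/\ E q (Y q), Ebar E q (Z q) & X q = Y q + Z q + a q *: zeta q]].
Proof.
move=> oV Vp vX; have [U0 [c [e [oU0 U0p U0c ac [ve0 be0]]]]] := local_frame p.
set r := n.-1 in e ve0 be0.
pose U := U0 `&` V; have oU : open U by exact: openI.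
have be q : U q -> is_basis (E q) (e^~ q) by case=> ? _; exact: be0.
have ve i : vfield U (e i) by apply: vfield_sub (ve0 i) => q [].
(* The local frame: [e], then its conjugate, then [zeta]. *)
pose b (k : 'I_(r + r + 1)) : field M := match fintype.split k with
  | inl k' => match fintype.split k' with inl i => e i | inr i => conjf (e i) end
  | inr _ => zeta end.
have sumE (a : 'I_(r + r + 1) -> C) q : \sum_(k < r + r + 1) a k *: b k q =
   \sum_(i < r) a (lshift 1 (lshift r i)) *: e i q +
   \sum_(i < r) a (lshift 1 (rshift r i)) *: conjv (e i q) + a (rshift (r + r) ord0) *: zeta q.
  rewrite !big_split_ord big_ord1 /b; congr (_ + _ + _).
  - by apply: eq_bigr => i _; rewrite !(unsplitK (inl _)).
  - by apply: eq_bigr => i _; rewrite (unsplitK (inl _)) (unsplitK (inr _)).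
  - by rewrite (unsplitK (inr _)).
have Ee (a : 'I_r -> C) q : U q -> E q (\sum_(i < r) a i *: e i q).
  by move=> Uq; apply/(be q Uq).1; exists a.
have Ebare (a : 'I_r -> C) q : U q -> Ebar E q (\sum_(i < r) a i *: conjv (e i q)).
  move=> Uq; rewrite /Ebar /= conjv_sum; apply/(be q Uq).1; exists (fun i => (a i)^*).
  by apply: eq_bigr => i _; rewrite conjvZ conjvK.
have vb k : vfield U (b k).
  rewrite /b; case: (fintype.split k) => [k'|_]; last exact: vfield_sub (spc_field spcE).
  by case: (fintype.split k') => i; [|apply: vfield_conj].
have free q : U q -> forall a : 'I_(r + r + 1) -> C,
    \sum_k a k *: b k q = 0 -> forall k, a k = 0.
  move=> Uq a; rewrite sumE => /(split0 (Ee _ q Uq) (Ebare _ q Uq)) [a1 a2 a3] k.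
  rewrite -(splitK k); case: (fintype.split k) => [k'|i] /=; last by rewrite ord1.
  rewrite -(splitK k'); case: (fintype.split k') => [i|i] /=.
    exact: ((be q Uq).2 _ a1).
  (* Conjugation turns a relation in [Ebar] into one among the [e i], with conjugate
     coefficients. *)
  have := congr1 (@conjv R m M) a2; rewrite conjv_sum conjv0 => a2'.
  apply/eqP; rewrite -conjc_eq0; apply/eqP.
  apply: ((be q Uq).2 (fun i => (a (lshift 1 (rshift r i)))^*)).
  by rewrite -[RHS]a2'; apply: eq_bigr => j _; rewrite conjvZ conjvK.
(* Independence suffices for a frame, since [2 n - 1 = (n - 1) + (n - 1) + 1] for positive [n]. *)
have mE : m = (r + r + 1)%N by rewrite (cr_dim crE) /r; lia.
have Uc : U `<=` cdom c by move=> q [/U0c].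
have vX' : vfield U X by apply: vfield_sub vX => q [].
have [a [sa Xa]] := frame_coefficients mE oU Uc ac vb free vX'.
exists U, (fun q => \sum_(i < r) a (lshift 1 (lshift r i)) q *: e i q),
  (fun q => \sum_(i < r) a (lshift 1 (rshift r i)) q *: conjv (e i q)),
  (a (rshift (r + r) ord0)).
split=> //.
- by move=> q [].
- apply: (vfield_ext (X := \sum_(i < r) (fun q => a (lshift 1 (lshift r i)) q *: e i q))) => //.
    by move=> q _; rewrite fct_sumE.
  by apply: vfield_sum => i; exact: vfieldM.
- by move=> q Uq; rewrite Xa // sumE; split=> //; [exact: Ee|exact: Ebare].
Qed.

Lemma vfield_prE V X : open V -> vfield V X -> vfield V (prE E zeta X).
Proof.
move=> oV vX; apply: vfield_local => p Vp.
have [U [Y [Z [a [oU Up UV vY XE]]]]] := local_splitting oV Vp vX.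
exists U; split=> //; apply: vfield_ext oU _ vY => q Uq.
by have [EY EZ XqE] := XE q Uq; rewrite /prE XqE cr_splitP.
Qed.

Lemma vfield_split X p : vfield setT X -> exists v w (a : C),
  [/\ E p v, Ebar E p w, X p = v + w + a *: zeta p, prE E zeta X p = v &
      prT' E zeta X p = w + a *: zeta p].
Proof.
move=> vX; have [U [Y [Z [a [_ Up _ _ XE]]]]] := local_splitting openT (I : setT p) vX.
have [EY EZ XpE] := XE p Up; exists (Y p), (Z p), (a p).
by rewrite /prT' /prE /prEbar /przeta XpE cr_splitP.
Qed.

(** For a smooth field the decomposition exists at every point, so [cr_split] does not fall back on
    its default value 0. This is how [dbar] is expressed through [P] alone. *)
Lemma prT'E X : vfield setT X -> prT' E zeta X = X - prE E zeta X.
Proof.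
move=> vX; apply/funext => p; have [v [w [a [_ _ Xp Ep Tp]]]] := vfield_split p vX.
rewrite [RHS](_ : _ = X p - prE E zeta X p) // Tp Ep Xp.
by rewrite -(addrA v) [RHS]addrAC subrr add0r.
Qed.

Lemma E_prE X p : vfield setT X -> E p (prE E zeta X p).
Proof. by move=> vX; have [v [w [a [Ev _ _ -> _]]]] := vfield_split p vX. Qed.

Lemma prED X Y : vfield setT X -> vfield setT Y ->
  prE E zeta (X + Y) = prE E zeta X + prE E zeta Y.
Proof.
move=> vX vY; apply/funext => p.
have [v [w [a [Ev Ew Xp Ep _]]]] := vfield_split p vX.
have [v' [w' [a' [Ev' Ew' Yp Ep' _]]]] := vfield_split p vY.
rewrite [RHS](_ : _ = prE E zeta X p + prE E zeta Y p) // Ep Ep' /prE.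
rewrite [(X + Y) p](_ : _ = X p + Y p) // Xp Yp addrACA (addrACA v) -scalerDl.
by rewrite cr_splitP //; [exact: E_D|exact: Ebar_D].
Qed.

Lemma prE_id X : (forall p, E p (X p)) -> prE E zeta X = X.
Proof.
move=> EX; apply/funext => p; rewrite /prE.
have := cr_splitP 0 (EX p) (Ebar_0 p).
by rewrite scale0r !addr0 => ->.
Qed.

Lemma prE_Ebar X : (forall p, Ebar E p (X p)) -> prE E zeta X = 0.
Proof.
move=> EX; apply/funext => p; rewrite /prE.
have := cr_splitP 0 (E_0 p) (EX p).
by rewrite scale0r add0r !addr0 => ->.
Qed.

Lemma GammaEP X : Gamma setT E X <-> vfield setT X /\ prE E zeta X = X.
Proof.
split=> [[vX EX]|[vX EX]]; split=> //.
- by apply: prE_id => p; exact: EX.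
- by move=> p _; rewrite -EX; exact: E_prE.
Qed.

(** Conjugation commutes with [lie], so involutivity passes from [E] to [Ebar]. *)
Lemma lie_Ebar X Y : vfield setT X -> vfield setT Y ->
  (forall p, Ebar E p (X p)) -> (forall p, Ebar E p (Y p)) ->
  forall p, Ebar E p (lie X Y p).
Proof.
move=> vX vY EX EY p.
have GX : Gamma setT E (conjf X) by split=> [|q _]; [exact: vfield_conj|exact: EX].
have GY : Gamma setT E (conjf Y) by split=> [|q _]; [exact: vfield_conj|exact: EY].
have [_ /(_ p I)] := cr_involutive crE openT GX GY.
by rewrite -conjf_lie.
Qed.

End Splitting.

(** * Global vector fields and cochains *)

Section GlobalFields.
Context {R : realType} {m : nat} (M : smooth_manifold R m).
Local Notation C := R[i].

Definition global_vfield : {pred field M} := fun X => `[< vfield setT X >].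

Lemma global_vfieldP X : reflect (vfield setT X) (X \in global_vfield).
Proof. exact: asboolP. Qed.

Fact global_vfield_zmod : zmod_closed global_vfield.
Proof.
split=> [|X Y /global_vfieldP vX /global_vfieldP vY]; apply/global_vfieldP.
  exact: vfield0.
by rewrite -[- Y]scaleN1r; apply: vfieldD => //; exact: vfieldZ.
Qed.

HB.instance Definition _ := GRing.isZmodClosed.Build (field M) global_vfield
  global_vfield_zmod.

Record gfield := MkGfield { gfield_val : field M; _ : gfield_val \in global_vfield }.
HB.instance Definition _ := [isSub for gfield_val].
HB.instance Definition _ := [Choice of gfield by <:].
HB.instance Definition _ := [SubChoice_isSubZmodule of gfield by <:].

Lemma gfieldP (x : gfield) : vfield setT (val x).
Proof. exact/global_vfieldP/(valP x). Qed.

Definition Gfield X (vX : vfield setT X) : gfield := Sub X (introT (global_vfieldP X) vX).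

Definition glie (x y : gfield) : gfield :=
  Gfield (vfield_lie openT (gfieldP x) (gfieldP y)).

Lemma val_sum (I : Type) (r : seq I) (F : I -> gfield) :
  val (\sum_(i <- r) F i) = \sum_(i <- r) val (F i).
Proof. exact: raddf_sum. Qed.

Lemma val_double_add (x y : gfield) : val (x *+ 2 + y) = val x *+ 2 + val y.
Proof. by rewrite raddfD raddfMn. Qed.

Lemma gfield_torsion_free (x : gfield) : x *+ 2 = 0 -> x = 0.
Proof.
move=> x2; apply: val_inj; apply/funext => p; apply/funext => f.
have := congr1 (fun z : gfield => val z p f : C) x2.
rewrite mulr2n => vx2; have /eqP : (val x p f : C) + val x p f = 0 := vx2.
by rewrite -mulr2n mulrn_eq0 /= => /eqP.
Qed.

Lemma glieC (x y : gfield) : glie x y = - glie y x.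
Proof. by apply: val_inj; rewrite raddfN; exact: lieC. Qed.

Lemma glieDl (y : gfield) : {morph glie^~ y : x x' / x + x'}.
Proof.
move=> x x'; apply: val_inj; rewrite raddfD.
exact: lieDl (gfieldP x) (gfieldP x') (gfieldP y).
Qed.

Lemma glie_jacobi (x y z : gfield) :
  glie (glie x y) z + glie (glie y z) x + glie (glie z x) y = 0.
Proof.
apply: val_inj; rewrite !raddfD raddf0.
exact: lie_jacobi (gfieldP x) (gfieldP y) (gfieldP z).
Qed.

End GlobalFields.

(** * [dbar] in degrees one and two, and one-forms as operators on fields *)

Section Cochains.
Context {R : realType} {m : nat} {M : smooth_manifold R m}.
Local Notation C := R[i].
Context (E : M -> set (functional M)) (zeta : field M).
Implicit Types (X Y Z : field M).

Definition pair_arg X Y : 'I_2 -> field M := fun i => if i == ord0 then X else Y.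

Lemma omit1_1 (V : 'I_2 -> field M) i : omit1 V i = fun _ => V (rev_ord i).
Proof.
apply/funext => j; rewrite /omit1; congr (V _); apply: val_inj; rewrite (ord1 j).
by case: i => [[|[|//]] ?].
Qed.

Lemma omit2_1 (V : 'I_2 -> field M) L i j : omit2 L V i j = fun _ => L.
Proof. by apply/funext => l; rewrite /omit2 (ord1 l). Qed.

Lemma dbar1E (u : vcochain M 1) X Y : dbar E zeta u (pair_arg X Y) =
  prT' E zeta (lie X (app u Y)) - prT' E zeta (lie Y (app u X)) - app u (lie X Y).
Proof.
rewrite /dbar !big_ord_recl !big_ord0 !addr0 big_mkcond [X in _ + (_ + X)]big_mkcond.
rewrite !big_ord_recl !big_ord0 /= !omit1_1 !omit2_1 /= !addr0.
by rewrite /bump /= expr0 !expr1 scale1r !scaleN1r add0r.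
Qed.

Lemma omit1_2 (V : 'I_3 -> field M) (i j k : 'I_3) : (i != j) && (i != k) && (j < k)%N ->
  omit1 V i = pair_arg (V j) (V k).
Proof.
move=> ijk; apply/funext => l; rewrite /omit1 /pair_arg.
case: ifP => l0; congr (V _); apply: val_inj; move: ijk l0;
  rewrite -!(inj_eq val_inj) /= /bump;
  case: i j k l => [i ?] [j ?] [k ?] [l ?] /=; lia.
Qed.

Lemma omit2_2 (V : 'I_3 -> field M) L i j k : i != j -> i != k -> j != k ->
  omit2 L V i j = pair_arg L (V k).
Proof.
move=> ij ik jk; apply/funext => l; rewrite /omit2 /pair_arg.
have -> : [seq h <- enum 'I_3 | (h != i) && (h != j)] = [:: k].
  apply: (inj_map val_inj) => /=.
  transitivity [seq h <- map val (enum 'I_3) | (h != val i) && (h != val j)].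
    by rewrite [RHS]filter_map; congr map; apply: eq_filter => h /=; rewrite -!(inj_eq val_inj).
  rewrite val_enum_ord; move: ij ik jk; rewrite -!(inj_eq val_inj) /=.
  by case: i j k => [[|[|[|//]]] ?] [[|[|[|//]]] ?] [[|[|[|//]]] ?].
by case: l => [[|[|//]] ?].
Qed.

Lemma dbar2E (beta : vcochain M 2) (V : 'I_3 -> field M) :
  let X := V ord0 in let Y := V (lift ord0 ord0) in
  let Z := V (lift ord0 (lift ord0 ord0)) in
  dbar E zeta beta V =
  prT' E zeta (lie X (beta (pair_arg Y Z))) - prT' E zeta (lie Y (beta (pair_arg X Z)))
  + prT' E zeta (lie Z (beta (pair_arg X Y)))
  - beta (pair_arg (lie X Y) Z) + beta (pair_arg (lie X Z) Y)
  - beta (pair_arg (lie Y Z) X).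
Proof.
move=> X Y Z.
rewrite /dbar !big_ord_recl !big_ord0 !addr0.
rewrite big_mkcond [X in _ + (_ + (X + _))]big_mkcond [X in _ + (_ + (_ + X))]big_mkcond.
rewrite !big_ord_recl !big_ord0 /= !addr0.
pose i1 : 'I_3 := lift ord0 (ord0 : 'I_2); pose i2 : 'I_3 := lift ord0 (lift ord0 (ord0 : 'I_1)).
rewrite (@omit1_2 V ord0 i1 i2) // (@omit1_2 V i1 ord0 i2) // (@omit1_2 V i2 ord0 i1) //.
rewrite (@omit2_2 V _ ord0 i1 i2) // (@omit2_2 V _ ord0 i2 i1) // (@omit2_2 V _ i1 i2 ord0) //.
rewrite -![V (lift _ _)]/Y -/X.
by rewrite /bump /= expr0 !expr1 sqrrN expr1n -signr_odd /= expr1 !scale1r !scaleN1r !add0r !addrA.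
Qed.

(** What the algebra asks of each [phi k]: an additive operator on global smooth fields with values
    in [Ebar]. *)
Definition ebar_endo (u : vcochain M 1) :=
  [/\ (forall X, vfield setT X -> vfield setT (app u X)),
      (forall X p, vfield setT X -> Ebar E p (app u X p)) &
      (forall X Y, vfield setT X -> vfield setT Y -> app u (X + Y) = app u X + app u Y)].

Lemma imath_inv_ebar_endo n (omega : cochain M n.+1) (alpha : cochain M (1 + n)) :
  (forall p, Ebar E p 0) -> ebar_endo (imath_inv E zeta omega alpha).
Proof.
(* The value of [imath_inv] is either a form chosen by [xget] or the default 0, an [Ebar]-valued
   operator as well. *)
move=> Ebar0; rewrite /imath_inv; case: xgetP => [u _ [vu _]|_]; last first.
  split=> [X _|X p _|X Y _ _]; [exact: vfield0|exact: Ebar0|].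
  by rewrite /app addr0.
have arg (X Y : field M) : set_arg ord0 Y (fun _ : 'I_1 => X) = fun _ => Y.
  by apply/funext => j; rewrite /set_arg (ord1 j) eqxx.
split=> [X vX|X p vX|X Y vX vY].
- by have [[]] := vu setT (fun=> X) openT (fun=> vX).
- by have [[_ /(_ p I)]] := vu setT (fun=> X) openT (fun=> vX).
apply/funext => p.
have [_ _ _ lin] := vu setT (fun=> X + Y) openT (fun=> vfieldD vX vY).
have := lin ord0 p 1 X Y I vX vY; rewrite !scale1r !arg; exact.
Qed.

End Cochains.

Theorem lemma1p4 (R : realType) (n : nat) (M : smooth_manifold R (2 * n - 1))
    (E : M -> set (functional M)) (zeta : field M) (omega : cochain M n.-1.+1)
    (l : nat) (phi : nat -> cochain M (1 + n.-1)) :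
  (7 <= 2 * n - 1)%N ->
  is_normal_spc E zeta n ->
  cr_trivialization E zeta omega ->
  (1 <= l)%N ->
  (forall k, (1 <= k <= l)%N -> in_Z E zeta n 1 (phi k)) ->
  let psi := fun k => imath_inv E zeta omega (phi k) in
  eq_vform E (dbar E zeta (psi 1%N)) 0 ->
  (forall k, (2 <= k <= l)%N ->
     eq_vform E (dbar E zeta (psi k))
       (- 2%:R^-1 *: \sum_(1 <= m < k) cr_bracket E zeta (psi m) (psi (k - m)%N))) ->
  eq_vform E (dbar E zeta
    (\sum_(1 <= m < l.+1) cr_bracket E zeta (psi m) (psi (l.+1 - m)%N))) 0.
Proof.
move=> n_ge4 spcE _ l_gt0 _ psi MC1 MC V EV.
have n_gt0 : (0 < n)%N by lia.
have Epsi k : ebar_endo E (psi k).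
  by apply: imath_inv_ebar_endo => p; exact: Ebar_0 spcE p.
have vpsi k X : vfield setT X -> vfield setT (app (psi k) X) by case: (Epsi k) => + _ _; apply.
pose P (x : gfield M) := Gfield (vfield_prE n_gt0 spcE openT (gfieldP x)).
(* The cut-off after order [l] supplies the condition [phi l.+1 = 0] of
   [maurer_cartan_step_dbar]. *)
pose e k (x : gfield M) := if (0 < k <= l)%N then Gfield (vpsi k _ (gfieldP x)) else 0.
have PD : {morph P : x y / x + y}.
  move=> x y; apply: val_inj; rewrite [RHS]raddfD.
  exact: prED n_gt0 spcE _ _ (gfieldP x) (gfieldP y).
have PK x : P (P x) = P x.
  apply: val_inj; apply: (prE_id spcE) => p.
  exact: E_prE n_gt0 spcE _ _ (gfieldP x).
have PE x : P x = x <-> Gamma setT E (val x).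
  split=> [Px|/(GammaEP n_gt0 spcE) [_ Px]]; last exact: val_inj.
  by apply/(GammaEP n_gt0 spcE); split; [exact: gfieldP|rewrite -[RHS](congr1 val Px)].
have P_lie x y : P x = x -> P y = y -> P (glie x y) = glie x y.
  move=> /PE Ex /PE Ey; apply/PE.
  exact: (cr_involutive (spc_cr spcE) openT Ex Ey).
have eD k : {morph e k : x y / x + y}.
  move=> x y; rewrite /e; case: ifP => _; last by rewrite addr0.
  apply: val_inj; rewrite [RHS]raddfD; case: (Epsi k) => _ _ psiD.
  exact: psiD _ _ (gfieldP x) (gfieldP y).
have Ebare k x p : Ebar E p (val (e k x) p).
  rewrite /e; case: ifP => _; last exact: Ebar_0 spcE p.
  by case: (Epsi k) => _ + _; apply; exact: gfieldP.
have Pe k x : P (e k x) = 0.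
  by apply: val_inj; exact: (prE_Ebar spcE (Ebare k x)).
have Pee j k x y : P (glie (e j x) (e k y)) = 0.
  apply: val_inj; apply: (prE_Ebar spcE).
  exact: (lie_Ebar spcE (gfieldP _) (gfieldP _) (Ebare j x) (Ebare k y)).
have bracketE m h x y : (0 < m <= l)%N -> (0 < h <= l)%N ->
    cr_bracket E zeta (psi m) (psi h) (pair_arg (val x) (val y)) =
    val (bracket1 (@glie R _ M) P e m h x y).
  by move=> ml hl; rewrite /bracket1 /e ml hl.
(* For [k] up to [l.+1], both [m] and [k - m] lie between 1 and [l], so the cut-off does not affect
   the sum. *)
have sumE k x y : (k <= l.+1)%N ->
    (\sum_(1 <= m < k) cr_bracket E zeta (psi m) (psi (k - m)%N)) (pair_arg (val x) (val y)) =
    val (\sum_(1 <= m < k) bracket1 (@glie R _ M) P e m (k - m)%N x y).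
  move=> kl; rewrite fct_sumE val_sum; apply: eq_big_nat => m mk.
  by apply: bracketE; lia.
have prT'V (x : gfield M) : prT' E zeta (val x) = val (x - P x).
  by rewrite raddfB; exact: (prT'E n_gt0 spcE (gfieldP x)).
have dbarE k x y : (0 < k <= l)%N ->
    dbar E zeta (psi k) (pair_arg (val x) (val y)) =
    val (dbar1 (@glie R _ M) P e k x y).
  move=> kl; rewrite dbar1E /dbar1 /e kl.
  rewrite (prT'E n_gt0 spcE (vfield_lie openT (gfieldP x) (vpsi k _ (gfieldP y)))).
  by rewrite (prT'E n_gt0 spcE (vfield_lie openT (gfieldP y) (vpsi k _ (gfieldP x)))).
have Epair x y : P x = x -> P y = y -> forall i, Gamma setT E (pair_arg (val x) (val y) i).
  by move=> /PE Ex /PE Ey i; rewrite /pair_arg; case: ifP.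
have e_maurer_cartan k x y : (0 < k <= l)%N -> P x = x -> P y = y ->
    dbar1 (@glie R _ M) P e k x y *+ 2 +
    \sum_(1 <= m < k) bracket1 (@glie R _ M) P e m (k - m)%N x y = 0.
  move=> kl Px Py; apply: val_inj; rewrite val_double_add -dbarE // -sumE; last by lia.
  (* For [k = 1] the sum of brackets is empty and the equation is [MC1]; for larger [k], doubling
     cancels the factor 1/2 of [MC]. *)
  have [k1|k1] := eqVneq k 1%N.
    by rewrite k1 big_nil (MC1 _ (Epair x y Px Py)) addr0 mul0rn.
  have /MC /(_ _ (Epair x y Px Py)) -> : (2 <= k <= l)%N by lia.
  set S := \sum_(_ <= _ < _) _.
  rewrite [(_ *: S) _](_ : _ = - 2%:R^-1 *: S (pair_arg (val x) (val y))) //.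
  rewrite scaleNr mulNrn -scaler_nat scalerA mulfV ?pnatr_eq0 // scale1r.
  exact: addNr.
pose x := Gfield (EV ord0).1; pose y := Gfield (EV (lift ord0 ord0)).1.
pose z := Gfield (EV (lift ord0 (lift ord0 ord0))).1.
have Px : P x = x by apply/PE; exact: EV.
have Py : P y = y by apply/PE; exact: EV.
have Pz : P z = z by apply/PE; exact: EV.
have e_last v : e l.+1 v = 0 by rewrite /e ltnn andbF.
have := maurer_cartan_step_dbar (@glieDl _ _ M) (@glieC _ _ M) (@glie_jacobi _ _ M) PD P_lie
  eD Pe PK Pee (@gfield_torsion_free _ _ M) e_last e_maurer_cartan Px Py Pz.
move=> /(congr1 val) eq0.
rewrite dbar2E -[RHS]eq0.
rewrite -[V ord0]/(val x) -[V (lift ord0 ord0)]/(val y) -[V _]/(val z).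
(* The brackets among the arguments are folded first, so that every argument of the sum of brackets
   is a bundled field, as [sumE] requires. *)
rewrite -[lie (val x) (val y)]/(val (glie x y)) -[lie (val x) (val z)]/(val (glie x z)).
rewrite -[lie (val y) (val z)]/(val (glie y z)) !sumE //.
rewrite -![lie (val _) (val _)]/(val (glie _ _)) !prT'V.
by [].
Qed.
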